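(* Consider the correlated Erdős–Rényi model with parameters $p=p_n$ and $s=s_n$. Assume $p=n^{-\Omega(1)}$. Let $\epsilon>0$ be an arbitrarily small fixed constant. (i) If $nps^2\ge(2+\epsilon)\max\left\{\frac{\log n}{\log(1/p)},\,2\right\}$, then there exists a constant $\delta>0$ such that $\mathbb{P}\{\mathrm{overlap}(\hat\pi_{\mathrm{ML}},\pi)\ge\delta\}=1-o(1)$. (ii) Conversely, assuming $np=\omega(\log^2 n)$, if $nps^2\le1-\epsilon$, then for any estimator $\hat\pi=\hat\pi(A,B)$ and any constant $\delta>0$, $\mathbb{P}\{\mathrm{overlap}(\hat\pi,\pi)\le\delta\}=1-o(1)$.
   Context: Let $\mathcal S_n$ be the set of permutations of $[n]=\{1,\dots,n\}$ and let the latent permutation $\pi$ be uniform on $\mathcal S_n$. The observations are two vectors $A=(A_{ij})_{1\le i<j\le n}$ and $B=(B_{ij})_{1\le i<j\le n}$ indexed by unordered pairs (so $A_{ij}=A_{ji}$, $B_{ij}=B_{ji}$) such that, conditionally on $\pi$, the pairs $(A_{\pi(i)\pi(j)},B_{ij})$, $1\le i<j\le n$, are i.i.d. with joint law $P$. In the correlated Erdős–Rényi model with parameters $(p,s)$, $p,s\in(0,1]$, set $q=ps$; $P$ is the joint law of two $\mathrm{Bern}(q)$ random variables $X,Y$ with $\mathbb{P}\{Y=1\mid X=1\}=s$. Equivalently, the graph with adjacency vector $(A_{\pi(i)\pi(j)})$ and the graph with adjacency vector $B$ are independently edge-subsampled with probability $s$ from a common parent graph $\mathcal G(n,p)$. Both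 $p$ and $s$ may depend on $n$. For $\pi'\in\mathcal S_n$ write $A^{\pi'}_{ij}=A_{\pi'(i)\pi'(j)}$ and $\langle A^{\pi'},B\rangle=\sum_{i<j}A_{\pi'(i)\pi'(j)}B_{ij}$. The maximum likelihood estimator is $\hat\pi_{\mathrm{ML}}\in\arg\max_{\pi'\in\mathcal S_n}\langle A^{\pi'},B\rangle$. For $\pi,\hat\pi\in\mathcal S_n$, $\mathrm{overlap}(\pi,\hat\pi)=\frac1n|\{i\in[n]:\pi(i)=\hat\pi(i)\}|$. An estimator is a function of $(A,B)$ with values in $\mathcal S_n$. Asymptotics are as $n\to\infty$; $\log$ is the natural logarithm. *)

(* Defs.v *)
From mathcomp Require Import all_boot all_order all_algebra all_fingroup.
From mathcomp Require Import all_classical all_reals all_analysis.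
From mathcomp Require Import ring lra.
Set Implicit Arguments.
Unset Strict Implicit.
Unset Printing Implicit Defensive.
Import Order.TTheory GRing.Theory Num.Theory.
Import numFieldNormedType.Exports.
Local Open Scope ring_scope.

(* The vertex set is 'I_n, and a pair i < j is encoded by the unordered pair
   {i, j}: a vector indexed by the pairs i < j is a function on [edge n], and
   the symmetry A_ij = A_ji is built into the index type. *)
Definition edge (n : nat) := {e : {set 'I_n} | #|e| == 2}.

Lemma edge_perm_proof n (sigma : 'S_n) (e : edge n) :
  #|[set sigma i | i in val e]| == 2.
Proof. by rewrite card_imset ?(valP e) //; exact: perm_inj. Qed.

(* {i, j} |-> {sigma i, sigma j} *)
Definition edge_perm n (sigma : 'S_n) (e : edge n) : edge n :=
  exist (fun e : {set 'I_n} => #|e| == 2) _ (edge_perm_proof sigma e).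

Definition adjacency (n : nat) := {ffun edge n -> bool}.

(* A^sigma, with entries A_{sigma(i) sigma(j)} *)
Definition relabel n (A : adjacency n) (sigma : 'S_n) : adjacency n :=
  [ffun e => A (edge_perm sigma e)].

Definition inner n (A B : adjacency n) : nat := (\sum_(e : edge n) A e * B e)%N.

Definition estimator (n : nat) := adjacency n -> adjacency n -> 'S_n.

(* No tie-breaking rule is imposed among the maximizers. *)
Definition is_MLE n (pihat : estimator n) : Prop :=
  forall (A B : adjacency n) (sigma : 'S_n),
    (inner (relabel A sigma) B <= inner (relabel A (pihat A B)) B)%N.

Section Model.
Variable R : realType.

Definition overlap n (sigma tau : 'S_n) : R :=
  #|[set i : 'I_n | sigma i == tau i]|%:R / n%:R.

(* The law P of (X, Y), where X and Y are Bern(q) with q = p s and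
   P(Y = 1 | X = 1) = s; these requirements determine the four masses
   (see the lemmas below). *)
Definition pair_law (p s : R) (x y : bool) : R :=
  let q := p * s in
  match x, y with
  | true, true => q * s
  | true, false => q * (1 - s)
  | false, true => q * (1 - s)
  | false, false => 1 - q - q * (1 - s)
  end.

Lemma pair_law_ge0 (p s : R) x y :
  0 < p <= 1 -> 0 < s <= 1 -> 0 <= pair_law p s x y.
Proof.
move=> /andP[p0 p1] /andP[s0 s1]; rewrite /pair_law.
have ps : 0 <= p * s by rewrite mulr_ge0 ?ltW.
have s1' : 0 <= 1 - s by rewrite subr_ge0.
have s0' := ltW s0.
case: x; case: y => /=; try exact: mulr_ge0.
have h : 0 <= p * (1 - s) ^+ 2 by rewrite mulr_ge0 ?sqr_ge0 ?ltW.
have -> : 1 - p * s - p * s * (1 - s) = (1 - p) + p * (1 - s) ^+ 2 by ring.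
by rewrite addr_ge0 // subr_ge0.
Qed.

Lemma pair_law_margl (p s : R) x :
  \sum_y pair_law p s x y = if x then p * s else 1 - p * s.
Proof. by rewrite big_bool; case: x; rewrite /pair_law /=; ring. Qed.

Lemma pair_law_margr (p s : R) y :
  \sum_x pair_law p s x y = if y then p * s else 1 - p * s.
Proof. by rewrite big_bool; case: y; rewrite /pair_law /=; ring. Qed.

Lemma pair_law_cond (p s : R) : 0 < p -> 0 < s ->
  pair_law p s true true / (\sum_y pair_law p s true y) = s.
Proof.
move=> p0 s0; rewrite pair_law_margl /pair_law /=.
by rewrite mulrC mulKf // mulf_neq0 // gt_eqF.
Qed.

(* Joint mass function of (pi, A, B): pi is uniform on 'S_n and, given pi, the
   pairs (A^pi e, B e) are i.i.d. with law [pair_law p s]. *)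
Definition joint_law n (p s : R) (pi : 'S_n) (A B : adjacency n) : R :=
  (n`!%:R)^-1 * \prod_(e : edge n) pair_law p s (relabel A pi e) (B e).

Definition prob n (p s : R) (E : 'S_n -> adjacency n -> adjacency n -> bool) : R :=
  \sum_(pi : 'S_n) \sum_(A : adjacency n) \sum_(B : adjacency n | E pi A B)
    joint_law p s pi A B.

Lemma relabel_bij n (sigma : 'S_n) : bijective (fun A => relabel A sigma).
Proof.
have K (t u : 'S_n) : (forall i, t (u i) = i) ->
    cancel (fun A => relabel A t) (fun A => relabel A u).
  move=> tu A; apply/ffunP => e; rewrite !ffunE; congr (A _).
  apply: val_inj => /=; apply/setP => i; apply/imsetP/idP.
    by move=> [j /imsetP[k ke ->] ->]; rewrite tu.
  by move=> ie; exists (u i); rewrite ?tu // imset_f.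
by exists (fun A => relabel A (sigma^-1)%g); apply: K => i; rewrite ?permK ?permKV.
Qed.

Lemma joint_law_marg n (p s : R) (pi : 'S_n) :
  \sum_(A : adjacency n) \sum_(B : adjacency n) joint_law p s pi A B
    = (n`!%:R)^-1.
Proof.
under eq_bigr => A _ do rewrite -mulr_sumr.
rewrite -mulr_sumr -[RHS]mulr1; congr (_ * _).
rewrite -(reindex (fun A => relabel A pi) (P := xpredT)
  (F := fun A : adjacency n => \sum_(B : adjacency n)
     \prod_(e : edge n) pair_law p s (A e) (B e))); last exact/onW_bij/relabel_bij.
under eq_bigr => A _ do
  rewrite -(bigA_distr_bigA (fun e : edge n => pair_law p s (A e))).
rewrite -(bigA_distr_bigA (fun (e : edge n) x => \sum_y pair_law p s x y)).
apply: big1 => e _.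
by under eq_bigr => x _ do rewrite pair_law_margl; rewrite big_bool /=; ring.
Qed.

Lemma prob_true n (p s : R) : prob p s (fun (_ : 'S_n) _ _ => true) = 1.
Proof.
rewrite /prob; under eq_bigr => pi _ do rewrite joint_law_marg.
by rewrite sumr_const card_Sn -[LHS]mulr_natr mulVf // pnatr_eq0 -lt0n fact_gt0.
Qed.

End Model.

(* Main.v *)
Require Import Defs.
From mathcomp Require Import all_boot all_order all_algebra all_fingroup.
From mathcomp Require Import all_classical all_reals all_analysis.
From mathcomp Require Import ring lra zify.
Set Implicit Arguments.
Unset Strict Implicit.
Unset Printing Implicit Defensive.
Import Order.TTheory GRing.Theory Num.Theory.
Import numFieldNormedType.Exports.
Local Open Scope ring_scope.

(** Let q = p s and x = n p s^2, essentially the mean degree of the intersection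
    graph, whose edges are the e with A^pi(e) = B(e) = 1.

    Part (i).  If the maximum likelihood estimator errs outside a small set F of
    vertices, some relabelling sigma with fixed set F matches A with B at least
    as well as the truth.  Edges inside F contribute equally to both sides, and
    uniformly in F they are a small fraction of the common edges, of which there
    are about n x / 2.  So about n x / 2 matches must come from the other edges,
    where sigma makes A and B nearly independent.  A Chernoff bound at rate
    t = 2 kappa log n / x, with kappa slightly above 1, has gain
    exp (kappa n log n), which beats the n! relabelings if the moment generating
    function is exp (o (n log n)).  Summed over B, this function is a sum over A
    of products of transfer matrices along the cycles of sigma acting on edges,
    which the generalized Hoelder inequality [cyclic_hoelder] bounds by the
    traces of the first and second powers of the matrix ([mgf_perm_le]).
    The exponent is then of order z x + (z x)^2 + n p z x with z = exp t - 1.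
    The bound x >= 4 + 2 eps makes exp t at most n^(rho / 2), and
    x >= (2 + eps) log n / log (1 / p) makes it at most p^-rho, for some rho < 1
    ([chernoff_exponent_le]).

    Part (ii).  The posterior weight of pi depends only on the number of edges
    of the intersection graph ([joint_law_inter]).  When two small components of
    this graph are isomorphic, composing pi with the exchange of the two
    preserves the common edges, and it creates no other common edge except with
    vanishing probability ([mean_invalid_swaps_le]).  The posterior is therefore
    invariant under these swaps, and an estimate cannot agree with pi at more than a
    bounded mean number of vertices having about n swap partners
    ([exchange_agreements]).  Below the threshold, components have bounded mean
    size ([mean_comp_le]), so all but a small fraction of the vertices lie in
    components of at most K vertices; these have boundedly many types, hence
    most vertices have order n partners ([small_vertices_sqr_le]), and the
    overlap vanishes ([high_overlap_le]). *)

(** * Hoelder's inequality along the cycles of a permutation *)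

Lemma cauchy_schwarz_sum (R : realDomainType) (I : finType) (f g : I -> R) :
  (\sum_i f i * g i) ^+ 2 <= (\sum_i f i ^+ 2) * (\sum_i g i ^+ 2).
Proof.
have h : 0 <= \sum_i \sum_j (f i * g j - f j * g i) ^+ 2.
  by apply: sumr_ge0 => i _; apply: sumr_ge0 => j _; exact: sqr_ge0.
have e2 : \sum_i \sum_j (f i * g j - f j * g i) ^+ 2 =
    ((\sum_i f i ^+ 2) * (\sum_i g i ^+ 2) - (\sum_i f i * g i) ^+ 2) *+ 2; last first.
  by rewrite -subr_ge0 -(pmulrn_lge0 _ (isT : 0 < 2)%N) -e2.
have E i j : (f i * g j - f j * g i) ^+ 2 =
  f i ^+ 2 * g j ^+ 2 + g i ^+ 2 * f j ^+ 2 - f i * g i * (f j * g j) *+ 2 by ring.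
under eq_bigr => i _ do (under eq_bigr => j _ do rewrite E;
  rewrite sumrB big_split /= sumrMnl -!mulr_sumr).
by rewrite sumrB big_split /= sumrMnl -!mulr_suml; ring.
Qed.

Section CyclicHoelder.
Variables (R : rcfType) (T S : finType).
Implicit Types (f : T -> S -> S -> R) (sigma : {perm T}).

Definition hs_norm (k : S -> S -> R) : R :=
  Num.sqrt (\sum_a \sum_b k a b ^+ 2).

Definition hoelder_cost sigma f (e : T) : R :=
  if sigma e == e then \sum_a f e a a else hs_norm (f e).

Definition upd (a : {ffun T -> S}) v c : {ffun T -> S} :=
  [ffun x => if x == v then c else a x].

Definition convol (k l : S -> S -> R) a b := \sum_c k a c * l c b.

Lemma hs_norm_ge0 k : 0 <= hs_norm k.
Proof. exact: sqrtr_ge0. Qed.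

Lemma sqr_hs_norm k : hs_norm k ^+ 2 = \sum_a \sum_b k a b ^+ 2.
Proof.
by rewrite sqr_sqrtr //; apply: sumr_ge0 => a _; apply: sumr_ge0 => b _; exact: sqr_ge0.
Qed.

Lemma trace_convol_le k l : \sum_a convol k l a a <= hs_norm k * hs_norm l.
Proof.
apply: le_trans (ler_norm _) _.
rewrite -ler_sqr ?nnegrE ?mulr_ge0 ?hs_norm_ge0 // real_normK ?num_real //.
rewrite exprMn !sqr_hs_norm (exchange_big _ _ _ _ _ (fun a b => l a b ^+ 2)) /=.
by rewrite !pair_bigA /= cauchy_schwarz_sum.
Qed.

Lemma hs_norm_convol_le k l : hs_norm (convol k l) <= hs_norm k * hs_norm l.
Proof.
rewrite -ler_sqr ?nnegrE ?mulr_ge0 ?hs_norm_ge0 //.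
rewrite exprMn !sqr_hs_norm (exchange_big _ _ _ _ _ (fun a b => l a b ^+ 2)) /=.
rewrite mulr_suml; apply: ler_sum => a _.
by rewrite mulr_sumr; apply: ler_sum => b _; exact: cauchy_schwarz_sum.
Qed.

Lemma hoelder_cost_ge0 sigma f e : (forall e a b, 0 <= f e a b) ->
  0 <= hoelder_cost sigma f e.
Proof.
by move=> f0; rewrite /hoelder_cost; case: ifP => _; [exact: sumr_ge0 | exact: hs_norm_ge0].
Qed.

(** The pairs (a, c) are permuted by the involution that exchanges c with the
    value of a at v. *)
Lemma sum_upd (F : {ffun T -> S} -> R) v : (0 < #|S|)%N ->
  \sum_a F a = \sum_a #|S|%:R^-1 * \sum_c F (upd a v c).
Proof.
move=> S0; rewrite -mulr_sumr pair_bigA /=.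
pose h (x : {ffun T -> S} * S) := (upd x.1 v x.2, x.1 v).
have hK : involutive h.
  move=> [a c]; rewrite /h /= ffunE eqxx; congr (_, _).
  by apply/ffunP => x; rewrite !ffunE; case: eqP => // ->.
have -> : \sum_x F (upd x.1 v x.2) = \sum_(x : {ffun T -> S} * S) F x.1.
  rewrite (reindex h) /=; last exact/onW_bij/inv_bij.
  by apply: eq_bigr => x _; rewrite -[upd _ _ _]/(h (h x)).1 hK.
rewrite -(pair_bigA _ (fun a (c : S) => F a)) /=.
under [in RHS]eq_bigr => x _ do rewrite sumr_const.
by rewrite sumrMnl -[X in _ * X]mulr_natl mulKf // pnatr_eq0 -lt0n.
Qed.

(** The generalized Hoelder inequality on the cycles of a permutation: every
    variable occurs in exactly two factors, and is summed out by the
    Cauchy-Schwarz inequality, which bypasses it in the permutation.  A cycle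
    that shrinks to a fixed point contributes a trace. *)
Lemma cyclic_hoelder sigma f : (0 < #|S|)%N -> (forall e a b, 0 <= f e a b) ->
  \sum_(a : {ffun T -> S}) \prod_e f e (a e) (a (sigma e))
    <= \prod_e hoelder_cost sigma f e.
Proof.
move=> S0; have [k] := ubnP #|[set e | sigma e != e]|.
elim: k sigma f => // k IH sigma f sk f0.
have [v /[!inE] vm|fix_all] := pickP [pred e | sigma e != e]; last first.
  have fixE e : sigma e = e by move/negbFE/eqP: (fix_all e).
  have -> : \sum_(a : {ffun T -> S}) \prod_e f e (a e) (a (sigma e)) =
      \sum_(a : {ffun T -> S}) \prod_e f e (a e) (a e).
    by apply: eq_bigr => a _; apply: eq_bigr => e _; rewrite fixE.
  rewrite -(bigA_distr_bigA (fun e a => f e a a)).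
  by rewrite le_eqVlt; apply/orP/or_introl/eqP/eq_bigr => e _; rewrite /hoelder_cost fixE eqxx.
pose u := (sigma^-1)%g v; pose w := sigma v; pose tau := (sigma * tperm v w)%g.
have su : sigma u = v by rewrite /u permKV.
have uv : u != v by apply: contraNneq vm => uv; rewrite -{1}uv su.
have tauv : tau v = v by rewrite permM tpermR.
have tauu : tau u = w by rewrite permM su tpermL.
have taue e : e != v -> e != u -> tau e = sigma e.
  move=> ev eu; rewrite permM tpermD // eq_sym.
    by apply: contraNneq eu => se; rewrite /u -se permK.
  by rewrite (inj_eq perm_inj).
(* The bypassed variable v keeps a constant factor of total mass one. *)
pose g e := if e == v then fun _ _ => #|S|%:R^-1 else
            if e == u then convol (f u) (f v) else f e.
have g0 e a b : 0 <= g e a b.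
  rewrite /g; case: ifP => _; first by rewrite invr_ge0.
  by case: ifP => _ //; apply: sumr_ge0 => c _; exact: mulr_ge0.
have tk : (#|[set e | tau e != e]| < k)%N.
  rewrite -ltnS; apply: leq_trans sk; rewrite ltnS; apply: proper_card.
  apply/properP; split; last by exists v; rewrite !inE ?tauv ?eqxx.
  apply/fintype.subsetP => e; rewrite !inE; have [->|ev] := eqVneq e v; first by rewrite tauv eqxx.
  by have [->|eu] := eqVneq e u; [rewrite su (eq_sym v) uv | rewrite taue].
have -> : \sum_(a : {ffun T -> S}) \prod_e f e (a e) (a (sigma e)) =
    \sum_(a : {ffun T -> S}) \prod_e g e (a e) (a (tau e)).
  rewrite (sum_upd _ v S0); apply: eq_bigr => a _.
  rewrite [RHS](bigD1 v) //= [X in _ = _ * X](bigD1 u) //= tauu.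
  rewrite {1}/g eqxx {1}/g (negPf uv) eqxx /convol; congr (_ * _).
  rewrite mulr_suml; apply: eq_bigr => c _.
  rewrite (bigD1 v) //= (bigD1 u) //= !ffunE eqxx (negPf uv) su eqxx (negPf vm).
  rewrite mulrCA !mulrA; congr (_ * _); apply: eq_bigr => e /andP[ev eu].
  rewrite !ffunE (negPf ev) -su (inj_eq perm_inj) (negPf eu) /g.
  by rewrite (negPf ev) (negPf eu) taue.
apply: le_trans (IH _ _ tk g0) _.
rewrite (bigD1 v) //= (bigD1 u) //= [leRHS](bigD1 v) //= [X in _ <= _ * X](bigD1 u) //=.
rewrite !mulrA; apply: ler_pM.
- by rewrite mulr_ge0 ?hoelder_cost_ge0.
- by apply: prodr_ge0 => e _; rewrite hoelder_cost_ge0.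
- rewrite {1}/hoelder_cost tauv eqxx {1}/g eqxx sumr_const -[X in X * _]mulr_natr.
  rewrite mulVf ?mul1r; last first.
    by rewrite pnatr_eq0 -lt0n.
  rewrite /hoelder_cost (negPf vm) su (eq_sym v) (negPf uv) tauu /g (negPf uv) eqxx mulrC.
  by case: ifP => _; [exact: trace_convol_le | exact: hs_norm_convol_le].
apply: ler_prod => e /andP[ev eu]; rewrite hoelder_cost_ge0 //=.
by rewrite /hoelder_cost taue // /g (negPf ev) (negPf eu).
Qed.

End CyclicHoelder.

(** * Expectation over the two graphs *)

Lemma edge_permM n (sigma tau : 'S_n) e :
  edge_perm (sigma * tau)%g e = edge_perm tau (edge_perm sigma e).
Proof.
apply: val_inj => /=; rewrite -imset_comp; apply: eq_imset => i /=.
by rewrite permM.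
Qed.

Lemma edge_perm1 n (e : edge n) : edge_perm 1%g e = e.
Proof.
apply: val_inj => /=; rewrite -[RHS]imset_id; apply: eq_imset => i /=.
by rewrite perm1.
Qed.

Lemma edge_perm_inj n (sigma : 'S_n) : injective (edge_perm sigma).
Proof.
by apply: (can_inj (g := edge_perm sigma^-1)) => e; rewrite -edge_permM mulgV edge_perm1.
Qed.

Lemma relabelM n (A : adjacency n) (sigma tau : 'S_n) :
  relabel (relabel A sigma) tau = relabel A (tau * sigma)%g.
Proof. by apply/ffunP => e; rewrite !ffunE edge_permM. Qed.

Lemma relabel1 n (A : adjacency n) : relabel A 1%g = A.
Proof. by apply/ffunP => e; rewrite !ffunE edge_perm1. Qed.

Section Mean.
Variables (R : realType) (n : nat) (p s : R).
Implicit Types (A B : adjacency n) (f g : adjacency n -> adjacency n -> R).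

(** Expectation over the pair (A, B) when the latent permutation is the
    identity, to which [prob_mean] reduces every probability. *)
Definition mean f : R :=
  \sum_(A : adjacency n) \sum_(B : adjacency n)
    (\prod_(e : edge n) pair_law p s (A e) (B e)) * f A B.

Lemma mean_prod (F : edge n -> bool -> bool -> R) :
  mean (fun A B => \prod_(e : edge n) F e (A e) (B e)) =
  \prod_(e : edge n) \sum_x \sum_y pair_law p s x y * F e x y.
Proof.
rewrite bigA_distr_bigA; apply: eq_bigr => A _.
by rewrite bigA_distr_bigA; apply: eq_bigr => B _; rewrite big_split.
Qed.

Lemma mean_cst c : mean (fun _ _ => c) = c.
Proof.
have one : mean (fun _ _ => 1) = 1.
  have := mean_prod (fun _ _ _ => 1); rewrite [RHS]big1 => [|e _].
    by move=> h; rewrite -[RHS]h; congr mean; apply/funext => A; apply/funext => B; rewrite big1_eq.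
  by rewrite !big_bool /pair_law /=; ring.
transitivity (c * mean (fun _ _ => 1)); last by rewrite one mulr1.
rewrite /mean mulr_sumr; apply: eq_bigr => A _; rewrite mulr_sumr.
by apply: eq_bigr => B _; rewrite mulr1 mulrC.
Qed.

Lemma meanD f g : mean (fun A B => f A B + g A B) = mean f + mean g.
Proof.
rewrite /mean -big_split; apply: eq_bigr => A _; rewrite -big_split.
by apply: eq_bigr => B _; rewrite mulrDr.
Qed.

Lemma meanZ c f : mean (fun A B => c * f A B) = c * mean f.
Proof.
rewrite /mean mulr_sumr; apply: eq_bigr => A _; rewrite mulr_sumr.
by apply: eq_bigr => B _; rewrite mulrCA.
Qed.

Lemma mean_sum (I : finType) (P : pred I) (F : I -> adjacency n -> adjacency n -> R) :
  mean (fun A B => \sum_(i | P i) F i A B) = \sum_(i | P i) mean (F i).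
Proof.
rewrite /mean [RHS]exchange_big; apply: eq_bigr => A _; rewrite [RHS]exchange_big.
by apply: eq_bigr => B _; rewrite mulr_sumr.
Qed.

(** Conditionally on pi, the pair (A^pi, B) has the law of (A, B) given that the
    latent permutation is the identity. *)
Lemma prob_mean (E : 'S_n -> adjacency n -> adjacency n -> bool) :
  prob p s E = (n`!%:R)^-1 *
    \sum_(pi : 'S_n) mean (fun A B => (E pi (relabel A pi^-1) B)%:R).
Proof.
rewrite /prob mulr_sumr; apply: eq_bigr => pi _.
rewrite /mean (reindex (fun A => relabel A (pi^-1)%g)); last exact/onW_bij/relabel_bij.
rewrite mulr_sumr; apply: eq_bigr => A _.
rewrite mulr_sumr big_mkcond; apply: eq_bigr => B _.
rewrite /joint_law relabelM mulgV relabel1.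
by case: (E _ _ _); rewrite ?mulr1 ?mulr0.
Qed.

Hypotheses (p01 : 0 < p <= 1) (s01 : 0 < s <= 1).

Lemma ler_mean f g : (forall A B, f A B <= g A B) -> mean f <= mean g.
Proof.
move=> fg; apply: ler_sum => A _; apply: ler_sum => B _; apply: ler_wpM2l => //.
by apply: prodr_ge0 => e _; exact: pair_law_ge0.
Qed.

Lemma mean_ge0 f : (forall A B, 0 <= f A B) -> 0 <= mean f.
Proof. by move=> f0; rewrite -[leLHS](mean_cst 0); exact: ler_mean. Qed.

Lemma prob_le_mean (E : 'S_n -> adjacency n -> adjacency n -> bool) c :
  (forall pi : 'S_n, mean (fun A B => (E pi (relabel A pi^-1) B)%:R) <= c) -> prob p s E <= c.
Proof.
move=> Ec; rewrite prob_mean mulrC ler_pdivrMr ?ltr0n ?fact_gt0 //.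
apply: le_trans (ler_sum _ (fun pi _ => Ec pi)) _.
by rewrite sumr_const card_Sn mulr_natr.
Qed.

Lemma prob_ge0 (E : 'S_n -> adjacency n -> adjacency n -> bool) : 0 <= prob p s E.
Proof.
rewrite prob_mean mulr_ge0 ?invr_ge0 //; apply: sumr_ge0 => pi _.
exact: mean_ge0.
Qed.

Lemma probC (E : 'S_n -> adjacency n -> adjacency n -> bool) :
  prob p s E = 1 - prob p s (fun pi A B => ~~ E pi A B).
Proof.
apply/eqP; rewrite -subr_eq opprK; apply/eqP; rewrite -(prob_true n p s) !prob_mean.
rewrite -mulrDr -big_split; congr (_ * _); apply: eq_bigr => pi _ /=.
rewrite -meanD; congr mean; apply/funext => A; apply/funext => B.
by case: (E _ _ _); rewrite ?addr0 ?add0r.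
Qed.

(** The exponential Markov inequality; the rate is absorbed in X and tau. *)
Lemma mean_chernoff (X : adjacency n -> adjacency n -> R) (tau : R) :
  mean (fun A B => (tau <= X A B)%R%:R) <= expR (- tau) * mean (fun A B => expR (X A B)).
Proof.
rewrite -meanZ; apply: ler_mean => A B; rewrite -expRD addrC.
have [h|h] := lerP tau (X A B); last exact: expR_ge0.
by rewrite -(expR0 R) ler_expR subr_ge0.
Qed.

End Mean.

(** * Moment generating functions of edge counts *)

Lemma prodr_scaled_indicator (R : comPzRingType) (T : finType) (D : {set T}) (z : R)
  (b : T -> bool) :
  \prod_(e in D) (1 + z * (b e)%:R) =
  \prod_e (1 + (if e \in D then z else 0) * (b e)%:R).
Proof.
by rewrite big_mkcond; apply: eq_bigr => e _; case: ifP; rewrite ?mul0r ?addr0.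
Qed.

Lemma expR_count (R : realType) (T : finType) (D : {set T}) (l : R) (b : T -> bool) :
  expR (l * (\sum_(e in D) b e)%N%:R) = \prod_(e in D) (1 + (expR l - 1) * (b e)%:R).
Proof.
rewrite natr_sum mulr_sumr expR_sum; apply: eq_bigr => e _.
by case: (b e); rewrite ?mulr1 ?mulr0 ?expR0 ?addr0 // addrC subrK.
Qed.

Section MomentGeneratingFunctions.
Variables (R : realType) (n : nat) (p s : R).
Implicit Types (sigma : 'S_n) (D : {set edge n}) (A B : adjacency n).

Definition edge_permp sigma : {perm edge n} := perm (@edge_perm_inj n sigma).

Lemma mgf_diag D z :
  mean p s (fun A B => \prod_(e in D) (1 + z * (A e && B e)%:R)) =
  (1 + z * (p * s ^+ 2)) ^+ #|D|.
Proof.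
have -> : (fun A B : adjacency n => \prod_(e in D) (1 + z * (A e && B e)%:R)) =
    (fun A B => \prod_e (1 + (if e \in D then z else 0) * (A e && B e)%:R)).
  by apply/funext => A; apply/funext => B; exact: prodr_scaled_indicator.
rewrite (mean_prod _ _ (fun e x y => 1 + (if e \in D then z else 0) * (x && y)%:R)).
rewrite -prodr_const [RHS]big_mkcond; apply: eq_bigr => e _.
by rewrite !big_bool /pair_law /=; case: ifP => _; ring.
Qed.

Hypotheses (p01 : 0 < p < 1) (s01 : 0 < s <= 1).

Let p01' : 0 < p <= 1. Proof. by case/andP: p01 => -> /ltW ->. Qed.

(** The transfer matrix of a cycle of edges, from one entry of A to the next
    one, after summation over the entry of B between them. *)
Definition transfer (z : R) (x x' : bool) : R :=
  \sum_y pair_law p s x y * (1 + z * (x' && y)%:R).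

Lemma transfer_ge0 z x x' : 0 <= z -> 0 <= transfer z x x'.
Proof.
move=> z0; apply: sumr_ge0 => y _; rewrite mulr_ge0 ?pair_law_ge0 //.
by rewrite addr_ge0 // mulr_ge0.
Qed.

Lemma mgf_transfer sigma D z :
  mean p s (fun A B => \prod_(e in D) (1 + z * (A (edge_perm sigma e) && B e)%:R)) =
  \sum_(A : adjacency n) \prod_e transfer (if e \in D then z else 0) (A e) (A (edge_permp sigma e)).
Proof.
rewrite /mean; apply: eq_bigr => A _; rewrite bigA_distr_bigA.
apply: eq_bigr => B _; rewrite prodr_scaled_indicator -big_split /=.
by apply: eq_bigr => e _; rewrite permE.
Qed.

(** Conjugating the transfer matrix by a diagonal one does not change the
    product over a permutation; the conjugation that makes the matrix symmetric
    also makes its Hilbert-Schmidt norm the square root of the trace of its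
    square, which is what the cyclic inequality needs. *)
Lemma mgf_perm_le sigma D z : 0 <= z ->
  (forall e, e \notin D -> edge_perm sigma e = e) ->
  mean p s (fun A B => \prod_(e in D) (1 + z * (A (edge_perm sigma e) && B e)%:R)) <=
  (1 + z * (p * s ^+ 2)) ^+ #|[set e in D | edge_perm sigma e == e]| *
  Num.sqrt (1 + (z * (p * s ^+ 2)) ^+ 2 + 2 * (z * (p * s) ^+ 2)) ^+ #|{: edge n}|.
Proof.
move=> z0 fixD; have /andP[p0 p1] := p01; have /andP[s0 s1] := s01.
set u := z * (p * s ^+ 2); set w := z * (p * s) ^+ 2.
have [p0' s0'] := (ltW p0, ltW s0).
have u0 : 0 <= u by rewrite !mulr_ge0 ?sqr_ge0.
have w0 : 0 <= w by rewrite !mulr_ge0 ?sqr_ge0.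
have ps1 : p * s < 1 by apply: le_lt_trans p1; rewrite ger_pMr.
have M01 : 0 < transfer z false true.
  rewrite (_ : transfer z false true = (1 - p * s) + p * s * (1 - s) * z).
    by rewrite ltr_pwDl ?subr_gt0 // !mulr_ge0 ?subr_ge0.
  by rewrite /transfer big_bool /pair_law /=; ring.
have M10 : 0 < transfer z true false.
  rewrite (_ : transfer z true false = p * s); first exact: mulr_gt0.
  by rewrite /transfer big_bool /pair_law /=; ring.
(* The factors gauge x' / gauge x telescope and make the off-diagonal entries
   of the transfer matrix equal. *)
pose gauge (x : bool) := if x then Num.sqrt (transfer z true false / transfer z false true) else 1.
have gauge0 x : 0 < gauge x by case: x; rewrite /gauge ?sqrtr_gt0 ?divr_gt0.
pose f e x x' := transfer (if e \in D then z else 0) x x' * (gauge x' / gauge x).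
have f0 e x x' : 0 <= f e x x'.
  by rewrite mulr_ge0 ?divr_ge0 ?transfer_ge0 ?(ltW (gauge0 _)) //; case: ifP.
rewrite mgf_transfer.
have -> : \sum_(A : adjacency n)
    \prod_e transfer (if e \in D then z else 0) (A e) (A (edge_permp sigma e)) =
    \sum_(A : adjacency n) \prod_e f e (A e) (A (edge_permp sigma e)).
  apply: eq_bigr => A _; rewrite /f [RHS]big_split /= big_split /= prodfV.
  rewrite -(reindex_inj (@perm_inj _ (edge_permp sigma)) (P := xpredT)
    (F := fun e => gauge (A e))) /=.
  rewrite divff ?mulr1 //; apply/prodf_neq0 => e _; exact/lt0r_neq0.
apply: le_trans (cyclic_hoelder _ _ f0) _; first by rewrite card_bool.
rewrite -prodr_const -[X in _ <= _ * X]prodr_const.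
rewrite [X in _ <= X * _]big_mkcond -big_split /=.
apply: ler_prod => e _; rewrite hoelder_cost_ge0 //= /hoelder_cost permE !inE.
have L1 : 1 <= Num.sqrt (1 + u ^+ 2 + 2 * w).
  rewrite -{1}(@sqrtr1 R) ler_sqrt.
    by rewrite -addrA lerDl addr_ge0 ?sqr_ge0 ?mulr_ge0.
  by rewrite -addrA addr_ge0 // addr_ge0 ?sqr_ge0 ?mulr_ge0.
case: ifP => [_|/negbT fe].
  rewrite /f big_bool !divff ?lt0r_neq0 // !mulr1 /transfer !big_bool /pair_law /=.
  case: ifP => eD; rewrite ?andbT ?andbF.
    rewrite [leLHS](_ : _ = 1 + u); last by rewrite /u; ring.
    by rewrite ler_peMr // addr_ge0.
  by rewrite [leLHS](_ : _ = 1) ?mul1r //; ring.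
have eD : e \in D by apply: contraNT fe => /fixD ->.
rewrite eD /= mul1r /f eD /hs_norm ler_wsqrtr // !big_bool /=.
have E x x' : (transfer z x x' * (gauge x' / gauge x)) ^+ 2 =
    transfer z x x' ^+ 2 * (gauge x' ^+ 2 / gauge x ^+ 2).
  by rewrite -exprVn -!exprMn.
have g1 : gauge true ^+ 2 = transfer z true false / transfer z false true.
  by rewrite /gauge sqr_sqrtr // divr_ge0 // ltW.
rewrite !E !g1 /gauge !expr1n.
rewrite [leLHS](_ : _ = transfer z true true ^+ 2 + transfer z false false ^+ 2 +
   2 * (transfer z true false * transfer z false true)); last first.
  by field; rewrite !lt0r_neq0.
rewrite le_eqVlt; apply/orP; left; apply/eqP.
by rewrite /transfer !big_bool /pair_law /u /w /=; ring.
Qed.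

End MomentGeneratingFunctions.

(** * Failure of the maximum likelihood estimator *)

Section EdgeSets.
Variable n : nat.
Implicit Types (F : {set 'I_n}) (sigma : 'S_n) (A B : adjacency n).

Definition fixset sigma : {set 'I_n} := [set i | sigma i == i].

Definition within F : {set edge n} := [set e : edge n | val e \subset F].

Definition edges_in (D : {set edge n}) A B : nat := (\sum_(e in D) (A e && B e))%N.

Lemma card_within F : #|within F| = 'C(#|F|, 2).
Proof.
rewrite -cards_draws -(card_imset _ val_inj); apply: eq_card => S.
apply/imsetP/idP => [[e /[!inE] eF ->]|/[!inE] /andP[SF S2]].
  by rewrite eF (valP e).
by exists (exist _ S S2); rewrite ?inE.
Qed.

Lemma card_edge : #|{: edge n}| = 'C(n, 2).
Proof.
rewrite -[in RHS](card_ord n) -[in RHS]cardsT -card_within.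
by rewrite -cardsT; apply: eq_card => e; rewrite !inE finset.subsetT.
Qed.

Lemma edge_perm_within sigma e :
  e \notin ~: within (fixset sigma) -> edge_perm sigma e = e.
Proof.
rewrite !inE negbK => /fintype.subsetP ef; apply: val_inj => /=.
rewrite -[RHS]imset_id; apply: eq_in_imset => i /ef.
by rewrite inE => /eqP.
Qed.

(** Such an edge is {i, sigma i} for a vertex i on a 2-cycle of sigma. *)
Lemma card_swapped_edges sigma :
  (#|[set e in ~: within (fixset sigma) | edge_perm sigma e == e]| <= n)%N.
Proof.
rewrite -(card_imset _ val_inj) -[X in (_ <= X)%N]card_ord.
apply: leq_trans (leq_imset_card (fun i => [set i; sigma i]) 'I_n).
apply/subset_leq_card/fintype.subsetP => S.
move=> /imsetP[e /[!inE] /andP[/subsetPn[i ie /[!inE] si] /eqP es] ->].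
apply/imsetP; exists i => //; apply/esym/eqP; rewrite eqEcard (eqP (valP e)).
rewrite cards2 eq_sym si andbT; apply/fintype.subsetP => j /set2P[]-> //.
by rewrite -{1}es /=; apply: imset_f.
Qed.

Lemma inner_split (D : {set edge n}) A B sigma :
  inner (relabel A sigma) B =
  (\sum_(e in D) (A (edge_perm sigma e) && B e) +
   \sum_(e in ~: D) (A (edge_perm sigma e) && B e))%N.
Proof.
rewrite /inner (bigID (mem D)) /=; congr addn; apply: eq_big => [e|e _].
- by [].
- by rewrite ffunE mulnb.
- by rewrite inE.
- by rewrite ffunE mulnb.
Qed.

(** The edges inside the fixed points of sigma contribute equally to both
    sides of the comparison, so only the others have to compensate. *)
Lemma inner_relabel_le sigma A B :
  (inner A B <= inner (relabel A sigma) B)%N ->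
  (inner A B <= edges_in (within (fixset sigma)) A B +
    \sum_(e in ~: within (fixset sigma)) (A (edge_perm sigma e) && B e))%N.
Proof.
move=> /leq_trans; apply; rewrite (inner_split (within (fixset sigma))) leq_add2r.
by apply: leq_sum => e ef; rewrite edge_perm_within // inE negbK.
Qed.

End EdgeSets.

Section MLE.
Variables (R : realType) (n : nat) (p s : R).
Hypotheses (n0 : (0 < n)%N) (p01 : 0 < p < 1) (s01 : 0 < s <= 1).

Let p01' : 0 < p <= 1. Proof. by case/andP: p01 => -> /ltW ->. Qed.

(** If the two graphs share more than a edges, fewer than b of which have both
    ends fixed by sigma, then for A^sigma to match B as well as A does, the other
    edges have to supply at least a - b matches. *)
Lemma mle_low_overlap_le (pihat : estimator n) (delta a b : R) : is_MLE pihat ->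
  prob p s (fun pi A B => ~~ (delta <= overlap R (pihat A B) pi)) <=
  mean p s (fun A B : adjacency n => ((inner A B)%:R <= a)%R%:R) +
  \sum_(F : {set 'I_n} | #|F|%:R < delta * n%:R)
    mean p s (fun A B : adjacency n => (b <= (edges_in (within F) A B)%:R)%R%:R) +
  \sum_(sigma : 'S_n) mean p s (fun A B : adjacency n =>
    (a - b <= (\sum_(e in ~: within (fixset sigma))
                 (A (edge_perm sigma e) && B e))%N%:R)%R%:R).
Proof.
move=> mle; apply: prob_le_mean => // pi.
rewrite -!mean_sum -!meanD; apply: ler_mean => // A B.
set A' := relabel A pi^-1; set sigma := (pihat A' B * pi^-1)%g.
have i0 (P : bool) : 0 <= P%:R :> R by [].
have s0 I (r : pred I) (l : seq I) (P : I -> bool) : 0 <= \sum_(i <- l | r i) (P i)%:R :> R.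
  exact: sumr_ge0.
rewrite -ltNge; case: ltP => [|_]; last by rewrite !addr_ge0.
rewrite ltr_pdivrMr ?ltr0n // => small.
have Fsmall : #|fixset sigma|%:R < delta * n%:R.
  apply: le_lt_trans small; rewrite ler_nat; apply/subset_leq_card/fintype.subsetP => i.
  by rewrite !inE permM => /eqP {2}<-; rewrite permKV.
have [ha|ha] := lerP (inner A B)%:R a; first by rewrite -addrA lerDl addr_ge0.
have [hb|hb] := lerP b (edges_in (within (fixset sigma)) A B)%:R.
  by rewrite (bigD1 (fixset sigma)) //= hb add0r -addrA lerDl addr_ge0.
have hx : a - b <= (\sum_(e in ~: within (fixset sigma))
    (A (edge_perm sigma e) && B e))%N%:R.
  have := mle A' B pi; rewrite !relabelM mulgV relabel1 => /inner_relabel_le.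
  by rewrite -(ler_nat R) natrD; lra.
by rewrite add0r (bigD1 sigma) //= hx addrCA lerDl addr_ge0.
Qed.

End MLE.

Lemma pow1D_le_expR (R : realType) (y : R) k : 0 <= 1 + y ->
  (1 + y) ^+ k <= expR (y * k%:R).
Proof. by move=> y0; rewrite expRM_natr lerXn2r ?nnegrE ?expR_ge0 ?expR_ge1Dx. Qed.

Lemma pow_sqrt1D_le_expR (R : realType) (y : R) k : 0 <= y ->
  Num.sqrt (1 + y) ^+ k <= expR (y / 2 * k%:R).
Proof.
move=> y0; rewrite expRM_natr lerXn2r ?nnegrE ?expR_ge0 ?sqrtr_ge0 //.
rewrite -ler_sqr ?nnegrE ?expR_ge0 ?sqrtr_ge0 // sqr_sqrtr ?addr_ge0 //.
rewrite -expRM_natr (_ : y / 2 * 2 = y); last by field.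
exact: expR_ge1Dx.
Qed.

Lemma expR_sub1_le (R : realType) (t : R) : expR t - 1 <= t * expR t.
Proof.
have := expR_ge1Dx (- t); rewrite -(ler_pM2r (expR_gt0 t)) -expRD addNr expR0; lra.
Qed.


Lemma fact_le_expn n : (n`! <= n ^ n)%N.
Proof.
elim: n => // n IH; rewrite factS expnS leq_mul2l (leq_trans IH) //.
by case: n {IH} => // n; rewrite leq_exp2r.
Qed.

Lemma fact_le_expR (R : realType) n : (n`!)%:R <= expR (n%:R * ln n%:R) :> R.
Proof.
case: n => [|n]; first by rewrite mul0r expR0.
by rewrite mulrC expRM_natr lnK ?posrE ?ltr0n // -natrX ler_nat fact_le_expn.
Qed.

Section Tails.
Variables (R : realType) (n : nat) (p s : R).
Hypotheses (p01 : 0 < p < 1) (s01 : 0 < s <= 1).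
Implicit Types (D : {set edge n}) (sigma : 'S_n).

Let p01' : 0 < p <= 1. Proof. by case/andP: p01 => -> /ltW ->. Qed.

Let ps2_01 : 0 <= p * s ^+ 2 <= 1.
Proof.
have /andP[p0 p1] := p01'; have /andP[s0 s1] := s01.
have [p0' s0'] := (ltW p0, ltW s0).
by rewrite mulr_ge0 ?sqr_ge0 //= mulr_ile1 ?sqr_ge0 // expr_le1.
Qed.

Lemma mgf_edges_in_le D l :
  mean p s (fun A B => expR (l * (edges_in D A B)%:R)) <=
  expR ((expR l - 1) * (p * s ^+ 2) * #|D|%:R).
Proof.
have /andP[m0 m1] := ps2_01.
have -> : (fun A B => expR (l * (edges_in D A B)%:R)) =
    (fun A B => \prod_(e in D) (1 + (expR l - 1) * (A e && B e)%:R)).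
  by apply/funext => A; apply/funext => B; exact: expR_count.
rewrite mgf_diag; apply: pow1D_le_expR.
have := expR_gt0 l; nra.
Qed.

Lemma edges_in_tail D l b : 0 <= l ->
  mean p s (fun A B => (b <= (edges_in D A B)%:R)%R%:R) <=
  expR (- (l * b) + (expR l - 1) * (p * s ^+ 2) * #|D|%:R).
Proof.
move=> l0; rewrite expRD; apply: (le_trans _ (ler_wpM2l (expR_ge0 _) (mgf_edges_in_le D l))).
apply: (le_trans _ (mean_chernoff _ _ _ _)) => //.
apply: ler_mean => // A B; rewrite ler_nat.
by case: (lerP b) => // h; rewrite lt0b ler_wpM2l.
Qed.

(** The Chernoff bound at rate eta, with exp (- eta) <= 1 / (1 + eta). *)
Lemma edges_in_lower_tail D eta : 0 <= eta ->
  mean p s (fun A B => ((edges_in D A B)%:R <= (1 - eta) * (p * s ^+ 2 * #|D|%:R))%R%:R) <=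
  expR (- (eta ^+ 3 / (1 + eta) * (p * s ^+ 2 * #|D|%:R))).
Proof.
move=> eta0; have /andP[m0 m1] := ps2_01.
set m := p * s ^+ 2 * _; have m_ge0 : 0 <= m by rewrite mulr_ge0.
apply: (@le_trans _ _ (expR (eta * (1 - eta) * m + (expR (- eta) - 1) * m))).
  rewrite expRD [X in _ * expR X]mulrA.
  apply: (le_trans _ (ler_wpM2l (expR_ge0 _) (mgf_edges_in_le D (- eta)))).
  rewrite -[X in expR X * _]opprK.
  apply: (le_trans _ (mean_chernoff _ _ _ _)) => //.
  apply: ler_mean => // A B; rewrite ler_nat.
  case: (lerP _ ((1 - eta) * m)) => // h; rewrite lt0b -mulrA mulNr lerN2.
  by rewrite ler_wpM2l.
rewrite ler_expR -mulrDl -mulNr ler_wpM2r //.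
have e1 : expR (- eta) <= (1 + eta)^-1.
  by rewrite expRN lef_pV2 ?posrE ?expR_gt0 ?expR_ge1Dx // ltr_pwDl.
apply: (@le_trans _ _ (eta * (1 - eta) + ((1 + eta)^-1 - 1))); first by lra.
rewrite le_eqVlt; apply/orP; left; apply/eqP; field.
by rewrite lt0r_neq0 // ltr_pwDl.
Qed.

(** The term in n comes from the edges {i, sigma i} of the 2-cycles of sigma,
    which sigma fixes although it moves their ends; the last term comes from the
    edges on longer cycles. *)
Lemma cross_tail sigma t z c : 0 <= t -> z = expR t - 1 ->
  mean p s (fun A B : adjacency n => (c <= (\sum_(e in ~: within (fixset sigma))
                 (A (edge_perm sigma e) && B e))%N%:R)%R%:R) <=
  expR (- (t * c) + z * (p * s ^+ 2) * n%:R +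
        ((z * (p * s ^+ 2)) ^+ 2 + 2 * (z * (p * s) ^+ 2)) / 2 * #|{: edge n}|%:R).
Proof.
move=> t0 zE; have /andP[m0 m1] := ps2_01.
have z0 : 0 <= z by rewrite zE subr_ge0 -(expR0 R) ler_expR.
set D := ~: within (fixset sigma).
have u0 : 0 <= z * (p * s ^+ 2) by rewrite mulr_ge0.
have w0 : 0 <= (z * (p * s ^+ 2)) ^+ 2 + 2 * (z * (p * s) ^+ 2).
  by rewrite addr_ge0 ?sqr_ge0 // mulr_ge0 // mulr_ge0 ?sqr_ge0.
rewrite -addrA expRD.
apply: (@le_trans _ _ (expR (- (t * c)) *
   mean p s (fun A B : adjacency n => \prod_(e in D) (1 + z * (A (edge_perm sigma e) && B e)%:R)))).
  have -> : (fun A B : adjacency n => \prod_(e in D) (1 + z * (A (edge_perm sigma e) && B e)%:R)) =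
    (fun A B => expR (t * (\sum_(e in D) (A (edge_perm sigma e) && B e))%N%:R)).
    by apply/funext => A; apply/funext => B; rewrite zE -expR_count.
  apply: (le_trans _ (mean_chernoff _ _ _ _)) => //.
  apply: ler_mean => // A B; rewrite ler_nat.
  by case: (lerP c) => // h; rewrite lt0b ler_wpM2l.
apply: ler_wpM2l; first exact: expR_ge0.
apply: le_trans (mgf_perm_le p01 s01 z0 (@edge_perm_within _ sigma)) _.
rewrite expRD; apply: ler_pM.
- by rewrite exprn_ge0 // addr_ge0.
- by rewrite exprn_ge0 // sqrtr_ge0.
- apply: le_trans (pow1D_le_expR _ _) _; first by rewrite addr_ge0.
  by rewrite ler_expR ler_wpM2l // ler_nat card_swapped_edges.
by rewrite -addrA; exact: pow_sqrt1D_le_expR.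
Qed.

End Tails.

Lemma bin2R (R : realFieldType) k : 'C(k, 2)%:R = k%:R * (k%:R - 1) / 2 :> R.
Proof.
elim: k => [|k IH]; first by rewrite bin0n mul0r mul0r.
by rewrite binS bin1 natrD IH -natr1; field.
Qed.

Section FailureBound.
Variables (R : realType) (n : nat) (p s eta kappa : R) (pihat : estimator n).
Hypotheses (n1 : (1 < n)%N) (p01 : 0 < p < 1) (s01 : 0 < s <= 1).
Hypotheses (eta01 : 0 < eta < 1) (kappa0 : 0 <= kappa).
Hypothesis (mle : is_MLE pihat).

(** x is, up to a factor 1 - 1 / n, the mean degree of the intersection graph,
    and log y is the rate of the Chernoff bound in [good_relabelings]. *)
Let x := n%:R * p * s ^+ 2.
Let L : R := ln n%:R.
Let y := expR (2 * kappa * L / x).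

Hypothesis x4 : 4 <= x.

Let p01' : 0 < p <= 1. Proof. by case/andP: p01 => -> /ltW ->. Qed.
Let n0 : 0 < n%:R :> R. Proof. by rewrite ltr0n ltnW. Qed.
Let x0 : 0 < x. Proof. by apply: lt_le_trans x4. Qed.
Let n1R : 1 <= n%:R :> R. Proof. by rewrite ler1n ltnW. Qed.
Let L0 : 0 <= L. Proof. by rewrite ln_ge0. Qed.
Let m := p * s ^+ 2 * #|{: edge n}|%:R.

Let mE : m = (n%:R - 1) * x / 2.
Proof. by rewrite /m card_edge bin2R /x; field. Qed.

Let few_edges : mean p s (fun A B : adjacency n =>
    ((inner A B)%:R <= (1 - eta) * m)%R%:R)
  <= expR (- (eta ^+ 3 / (1 + eta) * (2 * (n%:R - 1)))).
Proof.
have -> : (fun A B : adjacency n => ((inner A B)%:R <= (1 - eta) * m)%R%:R : R) =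
    (fun A B => ((edges_in [set: edge n]%SET A B)%:R <=
      (1 - eta) * (p * s ^+ 2 * #|[set: edge n]%SET|%:R))%R%:R).
  apply/funext => A; apply/funext => B; rewrite cardsT /m.
  suff -> : inner A B = edges_in [set: edge n]%SET A B by [].
  by apply: eq_big => e; rewrite ?inE // mulnb.
have /andP[e0 e1] := eta01.
apply: le_trans (edges_in_lower_tail _ _ _ _) _ => //; first exact: ltW.
rewrite ler_expR lerN2 cardsT -/m mE ler_wpM2l //.
  by rewrite divr_ge0 ?exprn_ge0 ?addr_ge0 // ltW.
by move: n1R x4; nra.
Qed.

(** At rate 2 / eta, a set of at most exp (- 1 / eta) n vertices is so small that
    its mean number of edges costs half of the gain n x.  With x >= 4, this
    leaves exp (- 2 n), which beats the 2^n choices of the set. *)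
Let dense_small_set (F : {set 'I_n}) : #|F|%:R < expR (- eta^-1) * n%:R ->
  mean p s (fun A B : adjacency n =>
    (eta * n%:R * x / 2 <= (edges_in (within F) A B)%:R)%R%:R) <= expR (- (2 * n%:R)).
Proof.
move=> Fs; have /andP[e0 e1] := eta01.
have l0 : 0 <= 2 / eta by rewrite divr_ge0 // ltW.
apply: le_trans (edges_in_tail _ _ _ _ l0) _ => //; rewrite ler_expR.
rewrite [2 / eta * _](_ : _ = n%:R * x); last by field; rewrite lt0r_neq0.
have d2 : expR (2 / eta) * expR (- eta^-1) ^+ 2 = 1.
  rewrite -expRM_natr -expRD [X in expR X](_ : _ = 0) ?expR0 //.
  by field; rewrite lt0r_neq0.
have wF : #|within F|%:R <= (expR (- eta^-1) * n%:R) ^+ 2 / 2.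
  rewrite card_within bin2R.
  have F0 : 0 <= #|F|%:R :> R by [].
  have : #|F|%:R ^+ 2 <= (expR (- eta^-1) * n%:R) ^+ 2.
    by rewrite ler_sqr ?nnegrE ?mulr_ge0 ?expR_ge0 // ltW.
  by nra.
have /andP[pp _] := p01; have /andP[s0 _] := s01.
have m0 : 0 <= p * s ^+ 2 by rewrite mulr_ge0 ?sqr_ge0 ?ltW.
have : (expR (2 / eta) - 1) * (p * s ^+ 2) * #|within F|%:R <=
    expR (2 / eta) * (p * s ^+ 2) * ((expR (- eta^-1) * n%:R) ^+ 2 / 2).
  apply: ler_pM => //; first by rewrite mulr_ge0 // subr_ge0 ltW // expR_gt1 divr_gt0.
  by rewrite ler_wpM2r //; lra.
have -> : expR (2 / eta) * (p * s ^+ 2) * ((expR (- eta^-1) * n%:R) ^+ 2 / 2) =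
    (expR (2 / eta) * expR (- eta^-1) ^+ 2) * (n%:R * x / 2).
  by rewrite /x; field.
rewrite d2 mul1r; move: n0 x4; nra.
Qed.

Let dense_small_sets :
  \sum_(F : {set 'I_n} | #|F|%:R < expR (- eta^-1) * n%:R)
    mean p s (fun A B : adjacency n =>
      (eta * n%:R * x / 2 <= (edges_in (within F) A B)%:R)%R%:R) <= expR (- n%:R).
Proof.
apply: (@le_trans _ _ (\sum_(F : {set 'I_n}) expR (- (2 * n%:R)))).
  rewrite big_mkcond; apply: ler_sum => F _; case: ifP => Fs; last exact: expR_ge0.
  exact: dense_small_set.
rewrite sumr_const -cardsT -powersetT card_powerset cardsT card_ord.
rewrite -[X in X <= _]mulr_natl natrX.
have e2 : 2 <= expR 1 :> R by have := expR_ge1Dx (1 : R); lra.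
apply: (@le_trans _ _ (expR (1 * n%:R) * expR (- (2 * n%:R)))).
  by rewrite ler_wpM2r ?expR_ge0 // expRM_natr lerXn2r ?nnegrE ?expR_ge0.
by rewrite -expRD ler_expR; lra.
Qed.

(** The n! relabelings cost exp (n log n).  The threshold is about n x / 2, so
    the rate 2 kappa log n / x gains exp (kappa n log n). *)
Let good_relabelings :
  \sum_(sigma : 'S_n) mean p s (fun A B : adjacency n =>
    ((1 - eta) * m - eta * n%:R * x / 2 <= (\sum_(e in ~: within (fixset sigma))
                 (A (edge_perm sigma e) && B e))%N%:R)%R%:R) <=
  expR (L * (n%:R * (1 - kappa * (1 - 2 * eta)) + kappa +
             2 * kappa * y + kappa ^+ 2 * L * y ^+ 2 + kappa * n%:R * (p * y))).
Proof.
have /andP[e0 e1] := eta01.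
have /andP[pp _] := p01; have /andP[s0 _] := s01.
have t0 : 0 <= 2 * kappa * L / x by rewrite divr_ge0 ?mulr_ge0 // ltW.
apply: le_trans (ler_sum _ (fun sigma _ => cross_tail p01 s01 sigma _ t0 (erefl _))) _.
rewrite sumr_const card_Sn -[X in X <= _]mulr_natl -/y.
apply: le_trans (ler_wpM2r (expR_ge0 _) (fact_le_expR R n)) _.
rewrite -expRD ler_expR -/L; set z := y - 1.
have z0 : 0 <= z by rewrite /z subr_ge0 -(expR0 R) ler_expR.
have y0 : 0 <= y by exact: expR_ge0.
have zx : z * x <= 2 * kappa * L * y.
  have := expR_sub1_le (2 * kappa * L / x); rewrite -/y -/z -(ler_pM2r x0).
  by rewrite mulrAC divfK // lt0r_neq0.
have zx0 : 0 <= z * x by rewrite mulr_ge0 // ltW.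
have -> : 2 * kappa * L / x * ((1 - eta) * m - eta * n%:R * x / 2) =
    kappa * L * (n%:R * (1 - 2 * eta) - (1 - eta)).
  by rewrite mE; field; rewrite lt0r_neq0.
have -> : z * (p * s ^+ 2) * n%:R = z * x by rewrite /x; ring.
have NE : #|{: edge n}|%:R <= n%:R ^+ 2 / 2 :> R.
  by rewrite card_edge bin2R; move: n0; nra.
have h1 : ((z * (p * s ^+ 2)) ^+ 2 + 2 * (z * (p * s) ^+ 2)) / 2 * #|{: edge n}|%:R <=
    kappa ^+ 2 * L ^+ 2 * y ^+ 2 + kappa * L * n%:R * (p * y).
  apply: (@le_trans _ _ (((z * (p * s ^+ 2)) ^+ 2 + 2 * (z * (p * s) ^+ 2)) / 2 * (n%:R ^+ 2 / 2))).
    rewrite ler_wpM2l // divr_ge0 // addr_ge0 ?sqr_ge0 //.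
    by rewrite mulr_ge0 // mulr_ge0 ?sqr_ge0.
  rewrite (_ : _ * _ = (z * x) ^+ 2 / 4 + n%:R * p * (z * x) / 2); last by rewrite /x; field.
  have h2 : (z * x) ^+ 2 <= (2 * kappa * L * y) ^+ 2.
    by rewrite ler_sqr ?nnegrE // (le_trans zx0).
  have np0 : 0 <= n%:R * p by rewrite mulr_ge0 // ltW.
  have h3 := ler_wpM2l np0 zx.
  by move: h2 h3; lra.
have h4 : 0 <= kappa * L * eta by rewrite !mulr_ge0 // ltW.
by move: zx h1 h4; lra.
Qed.

Lemma mle_failure_le :
  prob p s (fun pi A B => ~~ (expR (- eta^-1) <= overlap R (pihat A B) pi)) <=
  expR (- (eta ^+ 3 / (1 + eta) * (2 * (n%:R - 1)))) + expR (- n%:R) +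
  expR (L * (n%:R * (1 - kappa * (1 - 2 * eta)) + kappa +
             2 * kappa * y + kappa ^+ 2 * L * y ^+ 2 + kappa * n%:R * (p * y))).
Proof.
have nn : (0 < n)%N by apply: ltnW.
apply: le_trans (mle_low_overlap_le nn p01 s01 _ ((1 - eta) * m) (eta * n%:R * x / 2) mle) _.
by rewrite !lerD.
Qed.

End FailureBound.

(** * Swaps of small isomorphic components *)

Section LocalSwaps.
Variable n : nat.
Implicit Types (G A B : adjacency n) (sigma : 'S_n) (i j x y : 'I_n).

Definition inter A B : adjacency n := [ffun e => A e && B e].

Definition adj G : rel 'I_n :=
  fun x y => [exists e : edge n, (val e == [set x; y]%SET) && G e].

Definition comp G x : {set 'I_n} := [set y | connect (adj G) x y].

Definition local_swap K G i j sigma : bool :=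
  [&& relabel G sigma == G, (sigma * sigma == 1)%g, sigma i == j
    & #|[set x | sigma x != x]| <= K.*2]%N.

Definition swappable K G i j : bool := [exists sigma, local_swap K G i j sigma].

(** The choice depends on the graph alone: a swap that preserves the graph is
    therefore undone by repeating it. *)
Definition swapper K G i j : 'S_n := odflt 1%g [pick sigma | local_swap K G i j sigma].

Lemma swapperP K G i j : swappable K G i j -> local_swap K G i j (swapper K G i j).
Proof.
by rewrite /swapper; case: pickP => //= none /existsP[sigma]; rewrite none.
Qed.

Lemma edge_ends (e : edge n) : exists x y, x != y /\ val e = [set x; y]%SET.
Proof. by have /cards2P[x [y [xy exy]]] := valP e; exists x, y. Qed.

Lemma adjE G (e : edge n) x y : val e = [set x; y]%SET -> adj G x y = G e.
Proof.
move=> exy; apply/existsP/idP => [[e' /andP[/eqP e'xy]]|Ge]; last by exists e; rewrite exy eqxx.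
by rewrite (_ : e' = e) //; apply: val_inj; rewrite e'xy exy.
Qed.

Lemma adj_sym G : symmetric (adj G).
Proof. by move=> x y; apply: eq_existsb => e; rewrite finset.setUC. Qed.


Lemma connect_adj_sym G : fingraph.connect_sym (adj G).
Proof. exact/sym_connect_sym/adj_sym. Qed.

Lemma comp_adj G z x y : adj G x y -> (x \in comp G z) = (y \in comp G z).
Proof.
move=> xy; rewrite !inE; apply/idP/idP => h; apply: connect_trans h _; apply: connect1 => //.
by rewrite adj_sym.
Qed.

Lemma relabel_adj G sigma : (sigma * sigma = 1)%g ->
  (forall x y, adj G x y -> adj G (sigma x) (sigma y)) -> relabel G sigma = G.
Proof.
move=> ss h.
have step e : G e -> G (edge_perm sigma e).
  have [x [y [_ exy]]] := edge_ends e.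
  rewrite -(adjE G exy) => /h; rewrite (@adjE _ (edge_perm sigma e)) //=.
  by rewrite exy imsetU !imset_set1.
apply/ffunP => e; rewrite ffunE; apply/idP/idP => [/step|/step //].
by rewrite -edge_permM ss edge_perm1.
Qed.

(** The labelled shape of a small component, its vertices being numbered
    increasingly, together with the position of a vertex in it. *)
Definition comp_type K : finType := ('I_K.+1 * 'I_K.+1 * {ffun 'I_K * 'I_K -> bool})%type.

Definition type_of K G i : comp_type K :=
  (inord #|comp G i|, inord (index i (enum (comp G i))),
   [ffun ab : 'I_K * 'I_K => adj G (nth i (enum (comp G i)) ab.1) (nth i (enum (comp G i)) ab.2)]).

(** Numbering the vertices increasingly identifies two components of the same
    shape, and exchanging them moves at most 2K vertices.  In a single component,
    equal types force i = j. *)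
Lemma type_swappable K G i j :
  (#|comp G i| <= K)%N -> (#|comp G j| <= K)%N -> type_of K G i = type_of K G j ->
  swappable K G i j.
Proof.
move=> iK jK [/(congr1 val) /=]; rewrite !inordK ?ltnS // => cij.
have ii : i \in comp G i by rewrite inE connect0.
have jj : j \in comp G j by rewrite inE connect0.
have idx z y : y \in comp G z -> (index y (enum (comp G z)) < #|comp G z|)%N.
  by rewrite cardE index_mem mem_enum.
move=> /(congr1 val) /=; rewrite !inordK; last first.
- by rewrite (leq_trans (idx _ _ ii)) // (leq_trans iK).
- by rewrite (leq_trans (idx _ _ jj)) // (leq_trans jK).
move=> eidx /ffunP shape.
have [cc|ncc] := boolP (connect (adj G) i j).
  have eC : comp G i = comp G j.
    by apply/setP => y; rewrite !inE; exact: (same_connect (connect_adj_sym G)).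
  have eij : i = j.
    by rewrite -[LHS](@nth_index _ i i (enum (comp G i))) ?mem_enum // eidx eC nth_index ?mem_enum.
  rewrite -eij; apply/existsP; exists 1%g; rewrite /local_swap relabel1 mulg1 perm1 !eqxx /=.
  by rewrite (eq_card0 (A := [set x | _])) // => x; rewrite !inE perm1 eqxx.
have dis y : y \in comp G i -> y \in comp G j -> False.
  rewrite !inE => iy jy; move/negP: ncc; apply.
  by apply: connect_trans iy _; rewrite connect_adj_sym.
pose transport (C D : {set 'I_n}) x := nth x (enum D) (index x (enum C)).
have move_in (C D : {set 'I_n}) x : #|C| = #|D| -> x \in C -> transport C D x \in D.
  by move=> CD xC; rewrite -mem_enum mem_nth // -cardE -CD cardE index_mem mem_enum.
have moveK (C D : {set 'I_n}) x : #|C| = #|D| -> x \in C -> transport D C (transport C D x) = x.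
  move=> CD xC; rewrite /transport index_uniq ?enum_uniq ?nth_index ?mem_enum //.
  by rewrite -cardE -CD cardE index_mem mem_enum.
pose phi x := if x \in comp G i then transport (comp G i) (comp G j) x
  else if x \in comp G j then transport (comp G j) (comp G i) x else x.
have phiK : involutive phi.
  move=> x; rewrite {2}/phi; have [xi|xi] := boolP (x \in comp G i).
    have h := move_in _ _ _ cij xi; rewrite /phi h.
    by case: ifP => [/dis/(_ h)//|_]; exact: moveK.
  have [xj|xj] := boolP (x \in comp G j); last by rewrite /phi (negPf xi) (negPf xj).
  by have h := move_in _ _ _ (esym cij) xj; rewrite /phi h moveK.
have phiadj x y : adj G x y -> adj G (phi x) (phi y).
  move=> xy; have [ei ej] := (comp_adj i xy, comp_adj j xy).
  rewrite /phi -ei -ej.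
  have shapeE x' y' : x' \in comp G i -> y' \in comp G i ->
     adj G (transport (comp G i) (comp G j) x') (transport (comp G i) (comp G j) y') = adj G x' y'.
    move=> xi yi.
    have hx : (index x' (enum (comp G i)) < K)%N by rewrite (leq_trans (idx _ _ xi)).
    have hy : (index y' (enum (comp G i)) < K)%N by rewrite (leq_trans (idx _ _ yi)).
    have := shape (Ordinal hx, Ordinal hy); rewrite !ffunE /= !nth_index ?mem_enum // => ->.
    by congr (adj G _ _); apply: set_nth_default; rewrite -cardE -cij idx.
  case: ifP => [xi|_]; first by rewrite shapeE // -ei.
  case: ifP => // xj.
  have yj : y \in comp G j by rewrite -ej.
  by rewrite -shapeE ?moveK ?move_in.
have phi_inj : injective phi by exact: inv_inj.
apply/existsP; exists (perm phi_inj).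
have ss : (perm phi_inj * perm phi_inj = 1)%g.
  by apply/permP => x; rewrite permM !permE phiK.
rewrite /local_swap ss eqxx relabel_adj ?eqxx //=; last by move=> x y /phiadj; rewrite !permE.
rewrite permE /phi ii /transport eidx nth_index ?mem_enum // eqxx /=.
apply: (@leq_trans #|comp G i :|: comp G j|).
  apply/subset_leq_card/fintype.subsetP => x; rewrite !inE permE /phi !inE.
  by case: ifP => //= _; case: ifP => //; rewrite eqxx.
by rewrite -addnn (leq_trans (leq_card_setU _ _)) // leq_add.
Qed.

End LocalSwaps.

(** * Exchangeability under the posterior *)

Section Exchange.
Variables (R : realType) (n : nat) (p s : R) (K : nat).
Implicit Types (A B : adjacency n) (pi : 'S_n) (i j : 'I_n).

Lemma prod_pair_law A B :
  \prod_(e : edge n) pair_law p s (A e) (B e) =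
  \prod_x \prod_y pair_law p s x y ^+ #|[set e | (A e == x) && (B e == y)]|.
Proof.
rewrite (partition_big A xpredT) //=; apply: eq_bigr => x _.
rewrite (partition_big B xpredT) //=; apply: eq_bigr => y _.
rewrite -prodr_const; apply: eq_big => [e|e /andP[/eqP-> /eqP->] //].
by rewrite inE.
Qed.

(** The numbers of ones of A and B do not depend on the labelling, so the
    posterior weight is a function of the size of the intersection graph. *)
Lemma joint_law_inter A B pi pi' :
  inter (relabel A pi) B = inter (relabel A pi') B ->
  joint_law p s pi A B = joint_law p s pi' A B.
Proof.
move=> GE; rewrite /joint_law; congr (_ * _); rewrite !prod_pair_law.
pose c (pi : 'S_n) x y := #|[set e | (relabel A pi e == x) && (B e == y)]|.
suff cE x y : c pi x y = c pi' x y.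
  by apply: eq_bigr => x _; apply: eq_bigr => y _; congr (_ ^+ _); exact: cE.
have c11 : c pi true true = c pi' true true.
  rewrite /c; apply: eq_card => e; rewrite !inE !eqb_id.
  by have := congr1 (fun G : adjacency n => G e) GE; rewrite !ffunE.
have cB q z : (c q true z + c q false z = #|[set e | B e == z]|)%N.
  rewrite -(cardsID [set e | relabel A q e]); congr (_ + _)%N; apply: eq_card => e;
    by rewrite !inE; case: (relabel A q e); rewrite ?andbT ?andbF.
have cA q z : (c q z true + c q z false = #|[set e | A e == z]|)%N.
  have -> : #|[set e | A e == z]| = #|[set e | relabel A q e == z]|.
    rewrite -[RHS](card_imset _ (@edge_perm_inj n q)).
    apply: eq_card => e; rewrite inE; apply/idP/imsetP.
      move=> Ae; exists (edge_perm q^-1 e); last by rewrite -edge_permM mulVg edge_perm1.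
      by rewrite inE ffunE -edge_permM mulVg edge_perm1.
    by case=> e'; rewrite inE ffunE => h ->.
  rewrite -(cardsID [set e | B e]); congr (_ + _)%N; apply: eq_card => e;
    by rewrite !inE; case: (B e); rewrite ?andbT ?andbF.
move: (cB pi true) (cB pi false) (cA pi true) (cA pi false).
move: (cB pi' true) (cB pi' false) (cA pi' true) (cA pi' false) c11.
by move: x y => [] [] /=; lia.
Qed.

(** The swap is an automorphism of the intersection graph, so it loses no common
    edge; it is valid when it creates none. *)
Definition valid_swap A B pi i j : bool :=
  let G := inter (relabel A pi) B in
  swappable K G i j && (inter (relabel A (swapper K G i j * pi)%g) B == G).

Definition do_swap A B i j pi : 'S_n :=
  if valid_swap A B pi i j
  then (swapper K (inter (relabel A pi) B) i j * pi)%g else pi.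

Lemma do_swap_inter A B i j pi :
  inter (relabel A (do_swap A B i j pi)) B = inter (relabel A pi) B.
Proof. by rewrite /do_swap; case: ifP => // /andP[_ /eqP]. Qed.

Lemma valid_do_swap A B i j pi :
  valid_swap A B (do_swap A B i j pi) i j = valid_swap A B pi i j.
Proof.
rewrite [LHS]/valid_swap do_swap_inter /do_swap.
case: (boolP (valid_swap A B pi i j)) => [v|/negPf v]; last first.
  by rewrite -[LHS]/(valid_swap A B pi i j) v.
have /andP[sw _] : valid_swap A B pi i j by [].
rewrite sw /=.
have /and4P[_ /eqP ss _ _] := swapperP sw.
by rewrite mulgA ss mul1g eqxx.
Qed.

Lemma do_swapK A B i j : involutive (do_swap A B i j).
Proof.
move=> pi; rewrite {1}/do_swap valid_do_swap do_swap_inter /do_swap.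
case: (boolP (valid_swap A B pi i j)) => [v|//].
have /andP[sw _] : valid_swap A B pi i j by [].
have /and4P[_ /eqP ss _ _] := swapperP sw.
by rewrite mulgA ss mul1g.
Qed.

Hypotheses (p01 : 0 < p <= 1) (s01 : 0 < s <= 1).

Lemma joint_law_ge0 pi A B : 0 <= joint_law p s pi A B.
Proof.
rewrite mulr_ge0 ?invr_ge0 //; apply: prodr_ge0 => e _; exact: pair_law_ge0.
Qed.

(** A valid swap of i and j is an involution that preserves the posterior and
    turns the event rho i = pi i into rho i = pi j, which a single j satisfies
    for each i. *)
Lemma exchange_agreements A B (rho : 'S_n) :
  \sum_(pi : 'S_n) joint_law p s pi A B *
     (\sum_(i | rho i == pi i) #|[set j | valid_swap A B pi i j]|)%N%:R
  <= n%:R * \sum_(pi : 'S_n) joint_law p s pi A B.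
Proof.
have -> : \sum_(pi : 'S_n) joint_law p s pi A B *
     (\sum_(i | rho i == pi i) #|[set j | valid_swap A B pi i j]|)%N%:R =
   \sum_i \sum_j \sum_(pi : 'S_n)
     joint_law p s pi A B * ((rho i == pi i) && valid_swap A B pi i j)%:R.
  rewrite [RHS](eq_bigr _ (fun i _ => exchange_big _ _ _ _ _ _)) exchange_big /=.
  apply: eq_bigr => pi _; rewrite natr_sum mulr_sumr big_mkcond; apply: eq_bigr => i _.
  rewrite -mulr_sumr; case: ifP => h /=; last by rewrite big1_eq mulr0.
  by rewrite -natr_sum -sum1dep_card big_mkcond.
apply: (@le_trans _ _ (\sum_i \sum_(j : 'I_n) \sum_(pi : 'S_n)
     joint_law p s pi A B * (rho i == pi j)%:R)).
  apply: ler_sum => i _; apply: ler_sum => j _.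
  rewrite (reindex_inj (inv_inj (@do_swapK A B i j))).
  apply: ler_sum => pi _; rewrite (joint_law_inter (do_swap_inter _ _ _ _ _)) valid_do_swap.
  apply: ler_wpM2l; first exact: joint_law_ge0.
  rewrite ler_nat /do_swap; case: ifP => v; last by rewrite andbF.
  have /andP[sw _] := v; have /and4P[_ _ /eqP sij _] := swapperP sw.
  by rewrite permM sij; case: eqP.
rewrite [leLHS](eq_bigr _ (fun i _ => exchange_big _ _ _ _ _ _)) exchange_big /=.
rewrite mulr_sumr; apply: ler_sum => pi _.
have h i : \sum_(j : 'I_n) joint_law p s pi A B * (rho i == pi j)%:R = joint_law p s pi A B.
  rewrite (bigD1 (pi^-1 (rho i))%g) //= permKV eqxx mulr1 big1 ?addr0 // => j ji.
  case: eqP => [e|_]; last by rewrite mulr0.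
  by move: ji; rewrite e permK eqxx.
by rewrite (eq_bigr _ (fun i _ => h i)) sumr_const card_ord -[leLHS]mulr_natl.
Qed.

End Exchange.

(** * Invalid swaps are rare *)

Section InvalidSwaps.
Variables (R : realType) (n : nat) (p s : R) (K : nat).
Hypotheses (p01 : 0 < p <= 1) (s01 : 0 < s <= 1).
Implicit Types (A B G : adjacency n) (i j : 'I_n) (sigma : 'S_n).

Definition crossing A B (e e' : edge n) : bool :=
  [&& ~~ A e, B e, A e' & ~~ B e'].

(** An automorphism permutes the common edges, so a new common edge pairs two
    edges that are not common. *)
Lemma new_edge_crossing A B sigma :
  relabel (inter A B) sigma = inter A B -> inter (relabel A sigma) B != inter A B ->
  exists2 e, edge_perm sigma e != e & crossing A B e (edge_perm sigma e).
Proof.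
move=> aut ne.
have [e de|same] := pickP (fun e => inter (relabel A sigma) B e != inter A B e); last first.
  by move/negP: ne; case; apply/eqP/ffunP => e; have := same e; move/negbFE/eqP.
have := congr1 (fun G : adjacency n => G e) aut; rewrite !ffunE.
move: de; rewrite !ffunE => de autE; exists e.
  by apply: contraNneq de => ->.
by rewrite /crossing; move: de autE; case: (A e); case: (B e);
  case: (A (edge_perm _ _)); case: (B (edge_perm _ _)).
Qed.

(** Given the intersection graph, the entries at distinct edges are independent,
    and at an edge outside it A is 1, or B is 1, with probability at most p s. *)
Lemma mean_crossing_le (e e' : edge n) (H : adjacency n -> bool) : e != e' ->
  mean p s (fun A B => (H (inter A B) && crossing A B e e')%:R) <=
  (p * s) ^+ 2 * mean p s (fun A B => (H (inter A B))%:R).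
Proof.
move=> ee'; have /andP[p0 p1] := p01; have /andP[s0 s1] := s01.
have [p0' s0'] := (ltW p0, ltW s0).
pose psi (g : adjacency n) (f : edge n) x y := (((x && y) == g f)%:R : R).
pose phi (g : adjacency n) f x y := psi g f x y *
  (((f == e) ==> (~~ x && y)) && ((f == e') ==> (x && ~~ y)))%:R.
have prod_bool (F : edge n -> bool) : \prod_f (F f)%:R = [forall f, F f]%:R :> R.
  have [/forallP h|/forallPn[f nf]] := boolP [forall f, F f].
    by rewrite big1 // => f _; rewrite h.
  by rewrite (bigD1 f) //= (negPf nf) mul0r.
have interE A B g : (inter A B == g) = [forall f, (A f && B f) == g f].
  apply/eqP/forallP => [<- f|h]; first by rewrite ffunE.
  by apply/ffunP => f; rewrite ffunE; exact/eqP.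
have crossE A B : crossing A B e e' =
    [forall f, ((f == e) ==> (~~ A f && B f)) && ((f == e') ==> (A f && ~~ B f))].
  apply/and4P/forallP => [[a b c d] f|h].
    by apply/andP; split; apply/implyP => /eqP ->; apply/andP.
  by have := h e; have := h e'; rewrite !eqxx /= => /andP[_ /andP[-> ->]] /andP[/andP[-> ->]].
have psiE A B g : \prod_f psi g f (A f) (B f) = (inter A B == g)%:R.
  by rewrite interE -prod_bool.
have phiE A B g : \prod_f phi g f (A f) (B f) = (inter A B == g)%:R * (crossing A B e e')%:R.
  by rewrite big_split /= psiE crossE -prod_bool.
have pickG (G : adjacency n) (c : R) : \sum_(g | H g) (G == g)%:R * c = (H G)%:R * c.
  rewrite big_mkcond (bigD1 G) //= big1 ?addr0 => [|g gG].
    by case: (H G); rewrite ?eqxx ?mul0r.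
  by case: (H g); rewrite // eq_sym (negPf gG) mul0r.
have -> : mean p s (fun A B => (H (inter A B))%:R) =
    \sum_(g : adjacency n | H g) \prod_f \sum_x \sum_y pair_law p s x y * psi g f x y.
  under eq_bigr => g _ do rewrite -(mean_prod p s (psi g)).
  rewrite -mean_sum; congr mean; apply/funext => A; apply/funext => B.
  rewrite -[LHS]mulr1 -pickG; apply: eq_bigr => g _.
  by rewrite psiE mulr1.
have -> : mean p s (fun A B => (H (inter A B) && crossing A B e e')%:R) =
    \sum_(g : adjacency n | H g) \prod_f \sum_x \sum_y pair_law p s x y * phi g f x y.
  under eq_bigr => g _ do rewrite -(mean_prod p s (phi g)).
  rewrite -mean_sum; congr mean; apply/funext => A; apply/funext => B.
  rewrite -mulnb natrM -pickG; apply: eq_bigr => g _.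
  by rewrite phiE.
rewrite mulr_sumr; apply: ler_sum => g _.
have q0 : 0 <= p * s by rewrite mulr_ge0.
have psi0 f : 0 <= \sum_x \sum_y pair_law p s x y * psi g f x y.
  by apply: sumr_ge0 => x _; apply: sumr_ge0 => y _; rewrite mulr_ge0 ?pair_law_ge0.
have P01 : p * s * (1 - s) <= p * s * (1 - p * s + p * s * (1 - s)).
  apply: ler_wpM2l => //.
  have : p * s * s <= s * 1 by rewrite mulrC ler_wpM2l // mulr_ile1.
  lra.
have q2 : 0 <= p * s * (p * s * s) by rewrite !mulr_ge0.
apply: (@le_trans _ _ (\prod_f ((if (f == e) || (f == e') then p * s else 1) *
    \sum_x \sum_y pair_law p s x y * psi g f x y))).
  apply: ler_prod => f _; apply/andP; split.
    by apply: sumr_ge0 => x _; apply: sumr_ge0 => y _; rewrite !mulr_ge0 ?pair_law_ge0.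
  rewrite /phi; have [fe|fe] := eqVneq f e.
    rewrite fe (negPf ee') /psi !big_bool /pair_law /=.
    by case: (g e) => /=; lra.
  have [fe'|fe'] := eqVneq f e'.
    rewrite fe' /psi !big_bool /pair_law /=.
    by case: (g e') => /=; lra.
  by rewrite mul1r !big_bool !mulr1.
rewrite big_split /= ler_wpM2r //; first exact: prodr_ge0.
rewrite (bigD1 e) //= eqxx (bigD1 e') 1?eq_sym //= eqxx orbT big1 ?mulr1 // => f /andP[h1 h2].
by rewrite (negPf h1) (negPf h2).
Qed.

Lemma card_moved_edges sigma :
  (#|[set e : edge n | edge_perm sigma e != e]| <= #|[set x | sigma x != x]| * n)%N.
Proof.
rewrite -(card_imset _ val_inj).
have -> : (#|[set x | sigma x != x]| * n)%N =
    #|finset.setX [set x | sigma x != x] [set: 'I_n]%SET|.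
  by rewrite cardsX cardsT card_ord.
apply: leq_trans (leq_imset_card (fun xy : 'I_n * 'I_n => [set xy.1; xy.2]%SET) _).
apply/subset_leq_card/fintype.subsetP => S /imsetP[e /[!inE] he ->].
have [x [y [xy exy]]] := edge_ends e.
have [fx|fx] := eqVneq (sigma x) x; last first.
  by apply/imsetP; exists (x, y) => //=; rewrite !inE fx.
have [fy|fy] := eqVneq (sigma y) y; last first.
  by apply/imsetP; exists (y, x); rewrite /= ?inE ?fy // finset.setUC.
move/negP: he; case; apply/eqP/val_inj => /=.
by rewrite exy imsetU !imset_set1 fx fy.
Qed.

(** A local swap moves at most 2 K n edges. *)
Lemma mean_invalid_swaps_le :
  mean p s (fun A B => (\sum_i \sum_j (swappable K (inter A B) i j &&
     (inter (relabel A (swapper K (inter A B) i j)) B != inter A B)))%N%:R) <=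
  n%:R ^+ 2 * (K.*2 * n)%:R * (p * s) ^+ 2.
Proof.
have pos : 0 <= (p * s) ^+ 2 by exact: sqr_ge0.
have pair i j : mean p s (fun A B => (swappable K (inter A B) i j &&
     (inter (relabel A (swapper K (inter A B) i j)) B != inter A B))%:R) <=
     (K.*2 * n)%:R * (p * s) ^+ 2.
  pose H e e' G := [&& swappable K G i j, edge_perm (swapper K G i j) e == e' & e' != e].
  apply: (@le_trans _ _ (mean p s (fun A B => \sum_e \sum_e'
      (H e e' (inter A B) && crossing A B e e')%:R))).
    apply: ler_mean => // A B.
    have [/andP[sw new]|_] := boolP (_ && _); last first.
      by apply: sumr_ge0 => e _; apply: sumr_ge0.
    have /and4P[/eqP aut _ _ _] := swapperP sw.
    have [e me cr] := new_edge_crossing aut new.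
    rewrite (bigD1 e) //= (bigD1 (edge_perm (swapper K (inter A B) i j) e)) //= /H sw eqxx me cr.
    rewrite -addrA lerDl addr_ge0 //; first exact: sumr_ge0.
    by apply: sumr_ge0 => ? _; apply: sumr_ge0.
  rewrite mean_sum.
  under eq_bigr => e _ do rewrite mean_sum.
  apply: (@le_trans _ _ (\sum_(e : edge n) \sum_(e' : edge n)
     (p * s) ^+ 2 * mean p s (fun A B => (H e e' (inter A B))%:R))).
    apply: ler_sum => e _; apply: ler_sum => e' _.
    have [<-|ee'] := eqVneq e e'; last exact: mean_crossing_le.
    rewrite [leLHS](_ : _ = mean p s (fun A B => 0)).
      by rewrite mean_cst mulr_ge0 // mean_ge0.
    by congr mean; apply/funext => A; apply/funext => B; rewrite /H eqxx !andbF.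
  under eq_bigr => e _ do rewrite -mulr_sumr -mean_sum.
  rewrite -mulr_sumr -mean_sum mulrC ler_wpM2r //.
  rewrite -[leRHS](mean_cst n p s); apply: ler_mean => // A B.
  set G := inter A B; have [sw|nsw] := boolP (swappable K G i j); last first.
    rewrite big1 // => e _; rewrite big1 // => e' _.
    by rewrite /H (negPf nsw).
  have /and4P[_ _ _ small] := swapperP sw.
  set sigma := swapper K G i j.
  apply: (@le_trans _ _ (\sum_(e : edge n) (edge_perm sigma e != e)%:R)).
    apply: ler_sum => e _; rewrite (bigD1 (edge_perm sigma e)) //= big1 ?addr0.
      by rewrite /H sw eqxx.
    by move=> e' ne; rewrite /H [_ == e']eq_sym (negPf ne) andbF.
  rewrite -natr_sum ler_nat -big_mkcond /= sum1dep_card.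
  by apply: leq_trans (card_moved_edges _) _; rewrite leq_mul2r small orbT.
have -> : (fun A B => (\sum_i \sum_j (swappable K (inter A B) i j &&
     (inter (relabel A (swapper K (inter A B) i j)) B != inter A B)))%N%:R : R) =
   (fun A B => \sum_i \sum_j (swappable K (inter A B) i j &&
     (inter (relabel A (swapper K (inter A B) i j)) B != inter A B))%:R).
  apply/funext => A; apply/funext => B; rewrite natr_sum.
  by apply: eq_bigr => i _; rewrite natr_sum.
rewrite mean_sum; under eq_bigr => i _ do rewrite mean_sum.
apply: (@le_trans _ _ (\sum_(i : 'I_n) \sum_(j : 'I_n) (K.*2 * n)%:R * (p * s) ^+ 2)).
  by apply: ler_sum => i _; apply: ler_sum => j _; exact: pair.
rewrite !sumr_const !card_ord -mulrnA -[leLHS]mulr_natl natrM -expr2.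
by rewrite mulrA.
Qed.

End InvalidSwaps.

(** * Components of the subcritical intersection graph *)

Section Components.
Variable n : nat.
Implicit Types (A B G : adjacency n) (x y : 'I_n) (t : seq 'I_n).

Fixpoint path_edges x t : {set edge n} :=
  if t is y :: t' then [set e : edge n | val e == [set x; y]%SET] :|: path_edges y t'
  else finset.set0.

Lemma path_edges_sub x t e : e \in path_edges x t -> {subset val e <= x :: t}.
Proof.
elim: t x => [|y t IH] x /=; first by rewrite inE.
rewrite !inE => /orP[/eqP -> z|/IH h z /h].
  by rewrite !inE => /orP[] /eqP ->; rewrite eqxx ?orbT.
by rewrite !inE => ->; rewrite orbT.
Qed.

Lemma card_path_edges x t : uniq (x :: t) -> #|path_edges x t| = size t.
Proof.
elim: t x => [|y t IH] x /=; first by rewrite cards0.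
case/andP=> xy ut; rewrite cardsU IH // (_ : _ :&: _ = finset.set0) ?cards0 ?subn0; last first.
  apply/setP => e; rewrite !inE; apply/negP => /andP[/eqP exy /path_edges_sub /(_ x) h].
  have xe : x \in val e by have := set21 x y; rewrite -exy.
  by move/negP: xy; apply; exact: h.
have xny : x != y by move: xy; rewrite inE negb_or => /andP[].
have c2 : #|[set x; y]%SET| == 2 by rewrite cards2 xny.
pose exy : edge n := exist (fun S : {set 'I_n} => #|S| == 2) _ c2.
rewrite (_ : [set e : edge n | _] = [set exy]%SET) ?cards1 //.
by apply/setP => e; rewrite !inE -(inj_eq val_inj).
Qed.

Lemma path_edges_present G x t : path (adj G) x t -> forall e, e \in path_edges x t -> G e.
Proof.
elim: t x => [|y t IH] x /=; first by move=> _ e; rewrite inE.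
by move=> /andP[xy /IH h] e; rewrite !inE => /orP[/eqP exy|/h //]; rewrite -(adjE G exy).
Qed.

(** Every vertex of a component is the end of a self-avoiding path. *)
Lemma card_comp_le G x :
  (#|comp G x| <= \sum_(l < n) \sum_(t : l.-tuple 'I_n) (path (adj G) x t && uniq (x :: t)))%N.
Proof.
have end_of y : y \in comp G x -> exists l : 'I_n, exists t : l.-tuple 'I_n,
    [&& path (adj G) x t, uniq (x :: t) & last x t == y].
  rewrite inE => /connectP[t0 /shortenP[t pt ut _] ->].
  have lt : (size t < n)%N.
    by have := max_card (mem (x :: t)); rewrite (card_uniqP ut) card_ord.
  by exists (Ordinal lt), (in_tuple t); rewrite /= pt eqxx andbT.
have -> : (\sum_(l < n) \sum_(t : l.-tuple 'I_n) (path (adj G) x t && uniq (x :: t)))%N =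
    (\sum_(l < n) \sum_(t : l.-tuple 'I_n) \sum_y
      [&& path (adj G) x t, uniq (x :: t) & last x t == y])%N.
  apply: eq_bigr => l _; apply: eq_bigr => t _.
  rewrite (bigD1 (last x t)) //= eqxx andbT big1 ?addn0 // => y ne.
  by rewrite [_ == y]eq_sym (negPf ne) !andbF.
under eq_bigr => l _ do rewrite exchange_big.
rewrite exchange_big /= -sum1_card big_mkcond; apply: leq_sum => y _.
case: ifP => // /end_of[l [t h]].
by rewrite (bigD1 l) //= (bigD1 t) //= h.
Qed.

Variables (R : realType) (p s eps : R).
Hypotheses (p01 : 0 < p <= 1) (s01 : 0 < s <= 1) (eps0 : 0 < eps).

Lemma mean_path_le l x (t : l.-tuple 'I_n) :
  mean p s (fun A B => (path (adj (inter A B)) x t && uniq (x :: t))%:R) <= (p * s ^+ 2) ^+ l.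
Proof.
have /andP[p0 _] := p01; have /andP[s0 _] := s01.
have m0 : 0 <= p * s ^+ 2 by rewrite mulr_ge0 ?sqr_ge0 // ltW.
have [ut|nut] := boolP (uniq (x :: t)); last first.
  rewrite [leLHS](_ : _ = mean p s (fun A B : adjacency n => 0)).
    by rewrite mean_cst exprn_ge0.
  by congr mean; apply/funext => A; apply/funext => B; rewrite andbF.
rewrite -{2}(size_tuple t) -(card_path_edges ut) -prodr_const [leRHS]big_mkcond /=.
pose F e (a b : bool) : R := if e \in path_edges x t then (a && b)%:R else 1.
have -> : \prod_(e : edge n) (if e \in path_edges x t then p * s ^+ 2 else 1) =
    mean p s (fun A B => \prod_e F e (A e) (B e)).
  rewrite mean_prod; apply: eq_bigr => e _; rewrite /F.
  by case: ifP => _; rewrite !big_bool /pair_law /=; ring.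
apply: ler_mean => // A B; rewrite andbT.
have [/path_edges_present h|_] := boolP (path _ _ _).
  rewrite big1 // => e _; rewrite /F; case: ifP => // /h.
  by rewrite ffunE => ->.
by apply: prodr_ge0 => e _; rewrite /F; case: ifP.
Qed.

(** The expected number of self-avoiding paths of length l from a vertex is at
    most (n p s^2)^l, and the geometric series converges. *)
Lemma mean_comp_le x : n%:R * p * s ^+ 2 <= 1 - eps ->
  mean p s (fun A B => #|comp (inter A B) x|%:R) <= eps^-1.
Proof.
move=> sub; have /andP[p0 _] := p01; have /andP[s0 _] := s01.
have m0 : 0 <= n%:R * p * s ^+ 2 by rewrite !mulr_ge0 ?sqr_ge0 // ltW.
set r := n%:R * p * s ^+ 2 in sub m0.
apply: (@le_trans _ _ (\sum_(l < n) r ^+ l)).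
  apply: (@le_trans _ _ (mean p s (fun A B => \sum_(l < n) \sum_(t : l.-tuple 'I_n)
     (path (adj (inter A B)) x t && uniq (x :: t))%:R))).
    apply: ler_mean => // A B.
    rewrite (_ : \sum_(l < n) _ = (\sum_(l < n) \sum_(t : l.-tuple 'I_n)
       (path (adj (inter A B)) x t && uniq (x :: t)))%N%:R).
      by rewrite ler_nat card_comp_le.
    by rewrite natr_sum; apply: eq_bigr => l _; rewrite natr_sum.
  rewrite mean_sum; apply: ler_sum => l _; rewrite mean_sum.
  apply: (@le_trans _ _ (\sum_(t : l.-tuple 'I_n) (p * s ^+ 2) ^+ l)).
    by apply: ler_sum => t _; exact: mean_path_le.
  rewrite sumr_const card_tuple card_ord -[leLHS]mulr_natl natrX -exprMn mulrA.
  exact: lexx.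
have := subrX1 r n; move=> e1.
rewrite -(ler_pM2l eps0) divff ?lt0r_neq0 //.
apply: (@le_trans _ _ ((1 - r) * \sum_(l < n) r ^+ l)).
  by rewrite ler_wpM2r ?sumr_ge0 // => [i _|]; rewrite ?exprn_ge0 //; lra.
rewrite -opprB mulNr -e1 opprB; have := exprn_ge0 n m0; lra.
Qed.

End Components.

(** * Overlap in the subcritical regime *)

Section Impossibility.
Variables (R : realType) (n : nat).
Implicit Types (A B G : adjacency n) (i j : 'I_n) (pi : 'S_n).

(** Vertices of the same type are swappable, and by the Cauchy-Schwarz
    inequality the number of pairs of the same type is at least the square of
    the number of vertices over the number of types. *)
Lemma small_vertices_sqr_le K G (S : {set 'I_n}) :
  #|[set i in S | (#|comp G i| <= K)%N]|%:R ^+ 2 <=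
  #|comp_type K|%:R * (\sum_(i in S) #|[set j | swappable K G i j]|)%N%:R :> R.
Proof.
set S' := [set i in S | _].
pose c t := #|[set i in S' | type_of K G i == t]|.
have cs : \sum_t c t = #|S'| :> nat.
  rewrite -sum1_card (partition_big (type_of K G) xpredT) //=.
  by apply: eq_bigr => t _; rewrite /c -sum1dep_card; apply: eq_bigl => i; rewrite !inE.
have := cauchy_schwarz_sum (fun _ => 1 : R) (fun t => (c t)%:R : R).
rewrite (eq_bigr (fun t => (c t)%:R)) => [|t _]; last by rewrite mul1r.
rewrite -natr_sum cs [X in _ <= X * _](eq_bigr (fun _ => 1)) => [|t _]; last by rewrite expr1n.
rewrite sumr_const => /le_trans; apply; apply: ler_wpM2l => //.
rewrite (eq_bigr (fun t => (c t ^ 2)%N%:R)) => [|t _]; last by rewrite natrX.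
rewrite -natr_sum ler_nat.
apply: (@leq_trans (\sum_(i in S') c (type_of K G i))).
  rewrite (partition_big (type_of K G) xpredT) //=; apply: leq_sum => t _.
  rewrite (eq_bigr (fun _ => c t)) => [|i /andP[_ /eqP -> //]].
  rewrite sum_nat_cond_const -mulnn leq_mul2r /c; apply/orP; right.
  by apply/subset_leq_card/fintype.subsetP => i; rewrite !inE.
rewrite big_mkcond [leqRHS]big_mkcond; apply: leq_sum => i _.
case: ifP => [/[!inE] /andP[-> si]|_ //].
apply/subset_leq_card/fintype.subsetP => j /[!inE] /andP[/andP[_ sj] /eqP tij].
exact: type_swappable.
Qed.

Variables (p s : R).

Definition jmean (f : 'S_n -> adjacency n -> adjacency n -> R) : R :=
  \sum_(pi : 'S_n) \sum_(A : adjacency n) \sum_(B : adjacency n) joint_law p s pi A B * f pi A B.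

Lemma jmeanD f g : jmean (fun pi A B => f pi A B + g pi A B) = jmean f + jmean g.
Proof.
rewrite /jmean -big_split; apply: eq_bigr => pi _; rewrite -big_split.
apply: eq_bigr => A _; rewrite -big_split; apply: eq_bigr => B _; exact: mulrDr.
Qed.

Lemma jmeanZ c f : jmean (fun pi A B => c * f pi A B) = c * jmean f.
Proof.
rewrite /jmean mulr_sumr; apply: eq_bigr => pi _; rewrite mulr_sumr.
apply: eq_bigr => A _; rewrite mulr_sumr; apply: eq_bigr => B _; exact: mulrCA.
Qed.

Lemma jmean_relabel g : jmean (fun pi A B => g (relabel A pi) B) = mean p s g.
Proof.
have h pi : \sum_(A : adjacency n) \sum_(B : adjacency n)
    joint_law p s pi A B * g (relabel A pi) B = (n`!%:R)^-1 * mean p s g.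
  rewrite /mean mulr_sumr (reindex (fun A => relabel A (pi^-1)%g)); last exact/onW_bij/relabel_bij.
  apply: eq_bigr => A _; rewrite mulr_sumr; apply: eq_bigr => B _.
  by rewrite /joint_law relabelM mulgV relabel1 mulrA.
rewrite /jmean (eq_bigr _ (fun pi _ => h pi)) sumr_const card_Sn.
rewrite -[LHS]mulr_natl mulrA divff ?mul1r ?pnatr_eq0 -?lt0n ?fact_gt0 //.
Qed.

Hypotheses (p01 : 0 < p <= 1) (s01 : 0 < s <= 1).

Lemma prob_le_jmean (E : 'S_n -> adjacency n -> adjacency n -> bool) f :
  (forall pi A B, (E pi A B)%:R <= f pi A B) -> prob p s E <= jmean f.
Proof.
move=> Ef; apply: ler_sum => pi _; apply: ler_sum => A _.
rewrite big_mkcond; apply: ler_sum => B _.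
have J0 := joint_law_ge0 p01 s01 pi A B.
have := ler_wpM2l J0 (Ef pi A B).
by case: ifP; rewrite ?mulr1 ?mulr0.
Qed.

Lemma jmean_valid_le K (pihat : estimator n) :
  jmean (fun pi A B => (\sum_(i | pihat A B i == pi i)
           #|[set j | valid_swap K A B pi i j]|)%N%:R) <= n%:R.
Proof.
have swap3 (F : 'S_n -> adjacency n -> adjacency n -> R) :
    \sum_(pi : 'S_n) \sum_(A : adjacency n) \sum_(B : adjacency n) F pi A B =
    \sum_(A : adjacency n) \sum_(B : adjacency n) \sum_(pi : 'S_n) F pi A B.
  by rewrite exchange_big; apply: eq_bigr => A _; rewrite exchange_big.
rewrite /jmean swap3.
apply: (@le_trans _ _ (\sum_(A : adjacency n) \sum_(B : adjacency n)
    n%:R * \sum_(pi : 'S_n) joint_law p s pi A B)).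
  by apply: ler_sum => A _; apply: ler_sum => B _; exact: exchange_agreements.
under eq_bigr => A _ do rewrite -mulr_sumr.
by rewrite -mulr_sumr -swap3 -[X in _ * X]/(prob p s (fun _ _ _ => true)) prob_true mulr1.
Qed.

(** The first term bounds the square of the number of agreeing vertices in small
    components, through the number of swaps, valid or not, available at them; the
    second one bounds the number of vertices in large components. *)
Lemma high_overlap_le K (pihat : estimator n) (eps delta : R) :
  (0 < n)%N -> (0 < K)%N -> 0 < eps -> 0 < delta -> n%:R * p * s ^+ 2 <= 1 - eps ->
  prob p s (fun pi A B => ~~ (overlap R (pihat A B) pi <= delta)) <=
  4 * #|comp_type K|%:R / (delta * n%:R) ^+ 2 *
    (n%:R + n%:R ^+ 2 * (K.*2 * n)%:R * (p * s) ^+ 2) +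
  2 / (delta * n%:R * K%:R) * (n%:R / eps).
Proof.
move=> n0 K0 eps0 delta0 sub.
have nR : 0 < n%:R :> R by rewrite ltr0n.
have KR : 0 < K%:R :> R by rewrite ltr0n.
have d0 : 0 < delta * n%:R by rewrite mulr_gt0.
set a := 4 * _ / _; set b := 2 / _.
have a0 : 0 <= a by rewrite divr_ge0 ?sqr_ge0 // mulr_ge0.
have b0 : 0 <= b by rewrite divr_ge0 // mulr_ge0 ?(ltW d0).
pose V pi A B : R := (\sum_(i | pihat A B i == pi i) #|[set j | valid_swap K A B pi i j]|)%N%:R.
pose D A B : R := (\sum_i \sum_j (swappable K (inter A B) i j &&
     (inter (relabel A (swapper K (inter A B) i j)) B != inter A B)))%N%:R.
pose C A B : R := \sum_i #|comp (inter A B) i|%:R.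
apply: (@le_trans _ _ (jmean (fun pi A B =>
   a * (V pi A B + D (relabel A pi) B) + b * C (relabel A pi) B))); last first.
  rewrite jmeanD !jmeanZ jmeanD !(jmean_relabel) lerD // ler_wpM2l //.
    by apply: lerD; [exact: jmean_valid_le | exact: mean_invalid_swaps_le].
  rewrite /C mean_sum; apply: (@le_trans _ _ (\sum_(i : 'I_n) eps^-1)).
    by apply: ler_sum => i _; exact: mean_comp_le.
  by rewrite sumr_const card_ord -[leLHS]mulr_natl.
apply: prob_le_jmean => pi A B.
set G := inter (relabel A pi) B.
have V0 : 0 <= V pi A B by rewrite /V.
have D0 : 0 <= D (relabel A pi) B by rewrite /D.
have C0 : 0 <= C (relabel A pi) B by exact: sumr_ge0.
have [_|] := boolP (overlap _ _ _ <= delta).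
  by rewrite /= addr_ge0 // mulr_ge0 ?addr_ge0.
rewrite -ltNge ltr_pdivlMr // => big.
set S := [set i | pihat A B i == pi i]%SET in big.
set S' := [set i in S | (#|comp G i| <= K)%N].
have S'_le : #|S'|%:R ^+ 2 <= #|comp_type K|%:R * (V pi A B + D (relabel A pi) B).
  apply: le_trans (small_vertices_sqr_le K G S) _.
  apply: ler_wpM2l => //; rewrite -natrD ler_nat.
  rewrite [X in (_ <= X + _)%N]
    (_ : _ = \sum_(i in S) #|[set j | valid_swap K A B pi i j]|)%N; last first.
    by apply: eq_bigl => i; rewrite inE.
  apply: (@leq_trans (\sum_(i in S) (#|[set j | valid_swap K A B pi i j]| +
      \sum_j (swappable K G i j &&
       (inter (relabel (relabel A pi) (swapper K G i j)) B != G))))).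
    apply: leq_sum => i _; rewrite -!sum1dep_card.
    rewrite [leqLHS]big_mkcond [X in (_ <= X + _)%N]big_mkcond -big_split /=.
    apply: leq_sum => j _; rewrite /valid_swap -/G relabelM.
    by case: (swappable _ _ _ _); case: (_ == _).
  rewrite big_split leq_add2l /= [leqLHS]big_mkcond; apply: leq_sum => i _.
  by case: ifP.
have S_le : #|S|%:R <= #|S'|%:R + C (relabel A pi) B / K%:R.
  rewrite -lerBlDl ler_pdivlMr // mulrBl lerBlDl.
  rewrite -(cardsID [set i | (#|comp G i| <= K)%N] S) natrD mulrDl.
  rewrite (_ : S :&: _ = S'); last by apply/setP => i; rewrite !inE.
  rewrite lerD2l /C -natr_sum -natrM ler_nat -sum_nat_const big_mkcond.
  apply: leq_sum => i _; rewrite !inE -/G.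
  by case: ifP => // /andP[]; rewrite -ltnNge => /ltnW.
have [large|small] := lerP (delta * n%:R / 2) #|S'|%:R.
  apply: ler_wpDr; first exact: mulr_ge0 b0 C0.
  have h : (delta * n%:R / 2) ^+ 2 <= #|S'|%:R ^+ 2.
    by rewrite ler_sqr ?nnegrE // divr_ge0 // ltW.
  rewrite (_ : a * _ = 4 / (delta * n%:R) ^+ 2 *
    (#|comp_type K|%:R * (V pi A B + D (relabel A pi) B))); last by rewrite /a; ring.
  rewrite (_ : true%:R = 4 / (delta * n%:R) ^+ 2 * (delta * n%:R / 2) ^+ 2 :> R); last first.
    by rewrite -[LHS]/(1 : R); field; rewrite !lt0r_neq0.
  by rewrite ler_wpM2l ?divr_ge0 ?sqr_ge0 // (le_trans h).
apply: ler_wpDl; first exact: mulr_ge0 a0 (addr_ge0 V0 D0).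
rewrite (_ : b * _ = 2 / (delta * n%:R) * (C (relabel A pi) B / K%:R)); last first.
  by rewrite /b; field; rewrite !lt0r_neq0.
rewrite (_ : true%:R = 2 / (delta * n%:R) * (delta * n%:R / 2) :> R); last first.
  by rewrite -[LHS]/(1 : R); field; rewrite !lt0r_neq0.
rewrite ler_wpM2l ?divr_ge0 ?(ltW d0) //.
by move: big S_le small; lra.
Qed.

End Impossibility.

Local Open Scope classical_set_scope.
Local Open Scope ring_scope.

(** * Limits *)

Section Asymptotics.
Variable R : realType.

Lemma expRN_le (e v : R) : 0 < e -> e^-1 <= v -> expR (- v) <= e.
Proof.
move=> e0 ev; rewrite expRN -[leRHS]invrK lef_pV2 ?posrE ?invr_gt0 ?expR_gt0 //.
by apply: le_trans ev _; apply: le_trans (expR_ge1Dx v); lra.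
Qed.

Lemma mul_expRN_le (e a v : R) : 0 < e -> 0 < a -> 2 / (a ^+ 2 * e) <= v ->
  v * expR (- (a * v)) <= e.
Proof.
move=> e0 a0 ev.
have v0 : 0 < v by apply: lt_le_trans ev; rewrite divr_gt0 // mulr_gt0 ?exprn_gt0.
have av : 0 <= a * v by rewrite mulr_ge0 // ltW.
rewrite expRN ler_pdivrMr ?expR_gt0 //.
have := expR_ge1Dxn 1 av; rewrite !factS fact0 muln1 => h.
move: ev; rewrite ler_pdivrMr ?mulr_gt0 ?exprn_gt0 // => h2.
apply: (@le_trans _ _ (e * ((a * v) ^+ 2 / 2))); last first.
  by rewrite ler_pM2l //; apply: le_trans h; rewrite lerDr.
rewrite (_ : e * _ = v * (v * (a ^+ 2 * e)) / 2); last by field.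
by rewrite ler_pdivlMr // ler_wpM2l // ltW.
Qed.

Lemma near_ln_ge (M : R) : \forall n \near \oo, M <= ln (n%:R : R).
Proof.
near=> n.
have h : expR M <= n%:R :> R by near: n; exact: nbhs_infty_ger.
by rewrite -(expRK M) ler_ln // posrE ?expR_gt0 // (lt_le_trans (expR_gt0 M)).
Unshelve. all: by end_near. Qed.

Lemma prob_cvg1 (p s : nat -> R)
  (E : forall n, 'S_n -> adjacency n -> adjacency n -> bool) :
  (forall n, 0 < p n <= 1) -> (forall n, 0 < s n <= 1) ->
  (forall e, 0 < e -> \forall n \near \oo,
     prob (p n) (s n) (fun pi A B => ~~ E n pi A B) <= e) ->
  prob (p n) (s n) (E n) @[n --> \oo] --> (1 : R).
Proof.
move=> hp hs hE; apply/cvgrPdist_le => e e0; near=> n.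
rewrite probC // opprB addrC subrK ger0_norm ?prob_ge0 //.
by near: n; exact: hE.
Unshelve. all: by end_near. Qed.

(** With t = 2 kappa log n / x and rho < 1, the bound x >= 2 (2 + eps) gives
    exp t <= n^(rho / 2), which makes the correlation along cycles of edges
    negligible, and x >= (2 + eps) log n / log (1 / p) gives exp t <= p^-rho,
    which does the same for the mean of the inner product under independence. *)
Lemma chernoff_exponent_le (eps c p x L N : R) :
  0 < eps -> 0 < c -> 0 < p -> 0 < L -> N = expR L ->
  c * L <= ln (1 / p) ->
  (2 + eps) * Num.max (L / ln (1 / p)) 2 <= x ->
  let kappa := 1 + eps / 4 in let eta := eps / (16 + 4 * eps) in
  let rho := (1 + eps / 4) / (1 + eps / 2) in
  let y := expR (2 * kappa * L / x) in
  64 * kappa / eps <= N ->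
  128 * kappa / eps <= (1 - rho) * L ->
  2 / ((1 - rho) ^+ 2 * (eps / (64 * kappa ^+ 2))) <= L ->
  64 * kappa / eps <= (1 - rho) * c * L ->
  L * (N * (1 - kappa * (1 - 2 * eta)) + kappa +
       2 * kappa * y + kappa ^+ 2 * L * y ^+ 2 + kappa * N * (p * y)) <=
  - (eps / 16 * (L * N)).
Proof.
move=> eps0 c0 p0 L0 NE lpL xmax kappa eta rho y hN h1 h2 h3.
have k0 : 0 < kappa by rewrite /kappa; lra.
have lp0 : 0 < ln (1 / p) by apply: lt_le_trans lpL; exact: mulr_gt0.
set lp := ln (1 / p) in lpL xmax lp0.
have x1 : (2 + eps) * (L / lp) <= x.
  by apply: le_trans xmax; rewrite ler_wpM2l ?le_max ?lexx //; lra.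
have x2 : (2 + eps) * 2 <= x.
  by apply: le_trans xmax; rewrite ler_wpM2l ?le_max ?lexx ?orbT //; lra.
have x0 : 0 < x by lra.
have e2 : 0 < 1 + eps / 2 by lra.
have rho1 : 0 < 1 - rho.
  by rewrite /rho subr_gt0 ltr_pdivrMr //; lra.
have kE : 2 * kappa = rho * (2 + eps) by rewrite /kappa /rho; field; lra.
have rho0 : 0 < rho by rewrite /rho divr_gt0 //; lra.
have [L0' rho0'] := (ltW L0, ltW rho0).
have t1 : 2 * kappa * L / x <= rho / 2 * L.
  rewrite ler_pdivrMr // kE.
  rewrite (_ : rho / 2 * L * x = rho * L * (x / 2)); last by field.
  rewrite (_ : rho * _ * L = rho * L * (2 + eps)); last by ring.
  by rewrite ler_wpM2l ?(mulr_ge0 rho0' L0') //; lra.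
have t2 : 2 * kappa * L / x <= rho * lp.
  have h : (2 + eps) * L <= x * lp by rewrite -ler_pdivrMr // -mulrA.
  by rewrite ler_pdivrMr // kE; have := ler_wpM2l rho0' h; lra.
have N0 : 0 < N by rewrite NE expR_gt0.
have N0' := ltW N0.
have k0' := ltW k0.
have y1 : 1 <= y.
  rewrite /y -[leLHS](@expR0 R) ler_expR divr_ge0 ?mulr_ge0 ?ltW //.
have yy : y ^+ 2 <= N * expR (- ((1 - rho) * L)).
  by rewrite NE -expRD -expRM_natr ler_expR; move: t1; lra.
have py : p * y <= expR (- ((1 - rho) * c * L)).
  have pE : p = expR (- lp) by rewrite /lp div1r lnV ?posrE // opprK lnK.
  rewrite pE -expRD ler_expR.
  have : (1 - rho) * (c * L) <= (1 - rho) * lp by rewrite ler_wpM2l // ltW.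
  by move: t2; lra.
have b1 : kappa <= eps / 64 * N.
  by move: hN; rewrite ler_pdivrMr // => hN; lra.
have b2 : 2 * kappa * y <= eps / 64 * N.
  have : y <= N * (eps / (128 * kappa)).
    apply: (@le_trans _ _ (y ^+ 2)); first by rewrite expr2 ler_peMl // (le_trans _ y1).
    apply: le_trans yy _; rewrite ler_wpM2l //.
    by apply: expRN_le; rewrite ?divr_gt0 ?mulr_gt0 // invf_div.
  rewrite -(ler_pM2l (_ : 0 < 2 * kappa)) ?mulr_gt0 // => /le_trans; apply.
  by rewrite le_eqVlt; apply/orP; left; apply/eqP; field; rewrite lt0r_neq0.
have b3 : kappa ^+ 2 * L * y ^+ 2 <= eps / 64 * N.
  have h : L * expR (- ((1 - rho) * L)) <= eps / (64 * kappa ^+ 2).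
    by apply: mul_expRN_le => //; rewrite divr_gt0 ?mulr_gt0 ?exprn_gt0.
  apply: (@le_trans _ _ (kappa ^+ 2 * N * (eps / (64 * kappa ^+ 2)))); last first.
    by rewrite le_eqVlt; apply/orP; left; apply/eqP; field; rewrite lt0r_neq0.
  apply: (@le_trans _ _ (kappa ^+ 2 * N * (L * expR (- ((1 - rho) * L))))); last first.
    by rewrite ler_wpM2l // mulr_ge0 ?sqr_ge0 // ltW.
  rewrite (_ : _ * N * _ = kappa ^+ 2 * L * (N * expR (- ((1 - rho) * L)))); last by ring.
  by rewrite ler_wpM2l // mulr_ge0 ?sqr_ge0 // ltW.
have b4 : kappa * N * (p * y) <= eps / 64 * N.
  apply: (@le_trans _ _ (kappa * N * (eps / (64 * kappa)))); last first.
    by rewrite le_eqVlt; apply/orP; left; apply/eqP; field; rewrite lt0r_neq0.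
  rewrite ler_wpM2l ?mulr_ge0 //; apply: le_trans py _.
  by apply: expRN_le; rewrite ?divr_gt0 ?mulr_gt0 // invf_div.
have kE2 : 1 - kappa * (1 - 2 * eta) = - (eps / 8).
  by rewrite /kappa /eta; field; lra.
rewrite kE2 [leRHS](_ : _ = L * (- (eps / 16) * N)); last by ring.
by rewrite ler_wpM2l //; lra.
Qed.

Lemma mle_partial_recovery (p s : nat -> R) :
  (forall n, 0 < p n <= 1) -> (forall n, 0 < s n <= 1) ->
  (exists2 c : R, 0 < c & \forall n \near \oo, p n <= n%:R `^ (- c)) ->
  forall eps : R, 0 < eps ->
  (\forall n \near \oo,
      (2 + eps) * Num.max (ln n%:R / ln (1 / p n)) 2 <= n%:R * p n * s n ^+ 2) ->
  exists2 delta : R, 0 < delta &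
     forall pihat : (forall n : nat, estimator n),
       (forall n, is_MLE (pihat n)) ->
       prob (p n) (s n) (fun pi A B => delta <= overlap R (pihat n A B) pi)
         @[n --> \oo] --> (1 : R).
Proof.
move=> hp hs [c c0 hpoly] eps eps0 hx.
(* These values satisfy kappa * (1 - 2 * eta) = 1 + eps / 8. *)
pose kappa := 1 + eps / 4; pose eta := eps / (16 + 4 * eps).
pose rho := (1 + eps / 4) / (1 + eps / 2).
have k0 : 0 < kappa by rewrite /kappa; lra.
have rho1 : 0 < 1 - rho.
  by rewrite /rho subr_gt0 ltr_pdivrMr ?addr_gt0 ?divr_gt0 //; lra.
have eta01 : 0 < eta < 1.
  by rewrite /eta divr_gt0 /= ?ltr_pdivrMr; lra.
have /andP[eta0 eta1] := eta01.
exists (expR (- eta^-1)); first exact: expR_gt0.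
move=> pihat mle; apply: prob_cvg1 => // e e0.
have ce0 : 0 < eta ^+ 3 / (1 + eta) * 2 by rewrite mulr_gt0 ?divr_gt0 ?exprn_gt0 //; lra.
near=> n.
have n1 : (1 < n)%N by near: n; exact: nbhs_infty_gt.
have nR0 : 0 < n%:R :> R by rewrite ltr0n ltnW.
have L1 : 1 <= ln (n%:R : R) by near: n; exact: near_ln_ge.
have L0 : 0 < ln (n%:R : R) by lra.
have pn0 : 0 < p n by case/andP: (hp n).
have lp : c * ln n%:R <= ln (1 / p n).
  have : p n <= n%:R `^ (- c) by near: n.
  rewrite /powR gt_eqF // => pn; rewrite div1r lnV ?posrE // lerNr -mulNr.
  by rewrite -(expRK (- c * _)) ler_ln ?posrE ?expR_gt0.
have pn1 : p n < 1.
  have : 0 < ln (1 / p n) by apply: lt_le_trans lp; rewrite mulr_gt0.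
  by rewrite !ltNge; apply: contra => p1; rewrite ln_le0 // div1r invf_le1.
have xn : (2 + eps) * Num.max (ln n%:R / ln (1 / p n)) 2 <= n%:R * p n * s n ^+ 2 by near: n.
have x4 : 4 <= n%:R * p n * s n ^+ 2.
  apply: le_trans xn; apply: (@le_trans _ _ ((2 + eps) * 2)); first lra.
  by rewrite ler_wpM2l ?le_max ?lexx ?orbT //; lra.
have pn01 : 0 < p n < 1 by rewrite pn0.
apply: le_trans (mle_failure_le n1 pn01 (hs n) eta01 (ltW k0) (mle n) x4) _.
have t1 : expR (- (eta ^+ 3 / (1 + eta) * (2 * (n%:R - 1)))) <= e / 3.
  apply: expRN_le; first by rewrite divr_gt0.
  rewrite mulrA -ler_pdivrMl //.
  suff : (eta ^+ 3 / (1 + eta) * 2)^-1 * (e / 3)^-1 + 1 <= n%:R by lra.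
  by near: n; exact: nbhs_infty_ger.
have t2 : expR (- n%:R) <= e / 3.
  by apply: expRN_le; rewrite ?divr_gt0 //; near: n; exact: nbhs_infty_ger.
suff t3 : expR (- (eps / 16 * (ln n%:R * n%:R))) <= e / 3.
  have : e / 3 + e / 3 + e / 3 <= e by lra.
  apply: le_trans; apply: lerD; first exact: lerD.
  apply: le_trans t3; rewrite ler_expR.
  apply: (chernoff_exponent_le (c := c)) => //.
  - by rewrite lnK.
  - by near: n; exact: nbhs_infty_ger.
  - by rewrite -ler_pdivrMl //; near: n; exact: near_ln_ge.
  - by near: n; exact: near_ln_ge.
  - by rewrite -ler_pdivrMl ?mulr_gt0 //; near: n; exact: near_ln_ge.
apply: expRN_le; first by rewrite divr_gt0.
rewrite -ler_pdivrMl ?divr_gt0 //.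
apply: (@le_trans _ _ n%:R); first by near: n; exact: nbhs_infty_ger.
by rewrite ler_peMl // ltW.
Unshelve. all: by end_near. Qed.

End Asymptotics.

Section AsymptoticImpossibility.
Variable R : realType.

Lemma near_p_le (p : nat -> R) (c e : R) : 0 < c -> 0 < e ->
  (\forall n \near \oo, p n <= n%:R `^ (- c)) -> \forall n \near \oo, p n <= e.
Proof.
move=> c0 e0 hpoly; near=> n.
have n1 : 1 <= n%:R :> R by near: n; exact: nbhs_infty_ger.
have pn : p n <= n%:R `^ (- c) by near: n.
apply: le_trans pn _; rewrite /powR gt_eqF ?(lt_le_trans _ n1) // mulNr.
apply: expRN_le => //; rewrite -ler_pdivrMl //.
by near: n; exact: near_ln_ge.
Unshelve. all: by end_near. Qed.

(** The component size K is fixed first, to make the vertices of larger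
    components rare; the remaining terms vanish as n grows because p does. *)
Lemma subcritical_no_recovery (p s : nat -> R) :
  (forall n, 0 < p n <= 1) -> (forall n, 0 < s n <= 1) ->
  (exists2 c : R, 0 < c & \forall n \near \oo, p n <= n%:R `^ (- c)) ->
  forall eps : R, 0 < eps ->
  (\forall n \near \oo, n%:R * p n * s n ^+ 2 <= 1 - eps) ->
  forall (pihat : forall n : nat, estimator n) (delta : R), 0 < delta ->
    prob (p n) (s n) (fun pi A B => overlap R (pihat n A B) pi <= delta)
       @[n --> \oo] --> (1 : R).
Proof.
move=> hp hs [c c0 hpoly] eps eps0 sub pihat delta d0.
apply: prob_cvg1 => // e e0.
pose K := (Num.trunc (4 / (delta * eps * e))).+1.
have K4 : 4 / (delta * eps * e) <= K%:R.
  by apply/ltW/truncnS_gt.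
have KR : 0 < K%:R :> R by rewrite ltr0n.
pose M : R := #|comp_type K|%:R.
have M0 : 0 <= M by [].
pose e' := e * delta ^+ 2 / (16 * (M + 1) * (2 * K%:R)).
have e'0 : 0 < e'.
  by rewrite /e' divr_gt0 ?mulr_gt0 ?exprn_gt0 // ltr_wpDl.
near=> n.
have n1 : 1 <= n%:R :> R by near: n; exact: nbhs_infty_ger.
have n0 : 0 < n%:R :> R by apply: lt_le_trans n1.
have subn : n%:R * p n * s n ^+ 2 <= 1 - eps by near: n.
have ple : p n <= e' by near: n; exact: near_p_le hpoly.
have nle : 16 * (M + 1) / (e * delta ^+ 2) <= n%:R by near: n; exact: nbhs_infty_ger.
apply: le_trans (high_overlap_le (K := K) (hp n) (hs n) (pihat n) _ _ eps0 d0 subn) _ => //.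
  by rewrite -(ltr0n R).
rewrite [leRHS](_ : e = e / 2 + e / 2); last by field.
have /andP[p0 p1] := hp n; have /andP[s0 _] := hs n; have s0' := ltW s0.
have d2 : 0 < delta ^+ 2 by rewrite exprn_gt0.
apply: lerD; last first.
  rewrite [leLHS](_ : _ = 2 / (delta * eps) / K%:R); last by field; rewrite !lt0r_neq0.
  rewrite ler_pdivrMr // ler_pdivrMr ?mulr_gt0 //.
  move: K4; rewrite ler_pdivrMr ?mulr_gt0 //; lra.
rewrite [leLHS](_ : _ =
    4 * M / delta ^+ 2 * (n%:R^-1 + 2 * K%:R * (p n * (n%:R * p n * s n ^+ 2)))); last first.
  by rewrite natrM -muln2 natrM -/M; field; rewrite !lt0r_neq0.
have h1 : (M + 1) * n%:R^-1 <= e * delta ^+ 2 / 16.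
  rewrite ler_pdivrMr //; move: nle; rewrite ler_pdivrMr ?mulr_gt0 //; lra.
have h2 : (M + 1) * (2 * K%:R * p n) <= e * delta ^+ 2 / 16.
  move: ple; rewrite /e' ler_pdivlMr; last by rewrite !mulr_gt0 // ltr_wpDl.
  lra.
have h3 : p n * (n%:R * p n * s n ^+ 2) <= p n.
  by rewrite ler_piMr ?(ltW p0) //; lra.
have h4 : M * (n%:R^-1 + 2 * K%:R * (p n * (n%:R * p n * s n ^+ 2))) <=
    (M + 1) * (n%:R^-1 + 2 * K%:R * p n).
  apply: ler_pM => //.
  - rewrite addr_ge0 ?invr_ge0 ?(ltW n0) // !mulr_ge0 ?(ltW p0) ?(ltW n0) //.
  - by rewrite lerDl.
  - by rewrite lerD2l ler_wpM2l // mulr_ge0 // ltW.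
rewrite (_ : 4 * M / _ * _ = 4 / delta ^+ 2 *
    (M * (n%:R^-1 + 2 * K%:R * (p n * (n%:R * p n * s n ^+ 2))))); last by ring.
rewrite (_ : e / 2 = 4 / delta ^+ 2 * (e * delta ^+ 2 / 8)); last first.
  by field; rewrite lt0r_neq0.
by rewrite ler_wpM2l ?divr_ge0 ?(ltW d2) //; lra.
Unshelve. all: by end_near. Qed.

End AsymptoticImpossibility.

Theorem theorem3 (R : realType) (p s : nat -> R)
  (hp : forall n, 0 < p n <= 1)
  (hs : forall n, 0 < s n <= 1)
  (hpoly : exists2 c : R, 0 < c & \forall n \near \oo, p n <= n%:R `^ (- c))
  (eps : R) (heps : 0 < eps) :
  ((\forall n \near \oo,
      (2 + eps) * Num.max (ln n%:R / ln (1 / p n)) 2 <= n%:R * p n * s n ^+ 2) ->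
   exists2 delta : R, 0 < delta &
     forall pihat : (forall n : nat, estimator n),
       (forall n, is_MLE (pihat n)) ->
       prob (p n) (s n) (fun pi A B => delta <= overlap R (pihat n A B) pi)
         @[n --> \oo] --> (1 : R))
  /\
  (n%:R * p n / ln n%:R ^+ 2 @[n --> \oo] --> +oo ->
   (\forall n \near \oo, n%:R * p n * s n ^+ 2 <= 1 - eps) ->
   forall pihat : (forall n : nat, estimator n),
   forall delta : R, 0 < delta ->
     prob (p n) (s n) (fun pi A B => overlap R (pihat n A B) pi <= delta)
       @[n --> \oo] --> (1 : R)).
Proof.
split; first exact: mle_partial_recovery.
by move=> _ sub; exact: (subcritical_no_recovery hp hs hpoly heps sub).
Qed.
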